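(* Suppose that for each $m\in\mathfrak M$, $U_m$ is Lipschitz continuous over $[a_m,b_m]$ with random Lipschitz modulus $L_m$ almost surely, where $\mathbb{E}[L_m]<\infty$, and let $L:=\sum_{m\in\mathfrak M}L_m$. Then the following assertions hold. (i) Let $I$ (the set of breakpoints) be fixed. For any $\epsilon>0$ and $\delta>0$, there exists $N_0(\epsilon,\delta)=O(\ln\delta/\epsilon^2)$ such that $$\mathrm{Prob}\left(|\vartheta_{N,I}-\vartheta|\ge\epsilon\right)\le\delta$$ for all $N\ge N_0(\epsilon,\delta)$ and $\Delta\le\frac{\epsilon}{2\mathbb{E}[L]}$. (ii) For any positive number $\epsilon$, $$\lim_{N,I\to\infty}\mathrm{Prob}\left(|\vartheta_{N,I}-\vartheta|\ge\epsilon\right)=0$$ and $$\lim_{N,I\to\infty}\mathrm{Prob}\left(\mathbb{D}(X_{N,I},X^* )\ge\epsilon\right)=0.$$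
   Context: $\mathfrak M=\{1,\dots,M\}$ indexes the attributes. For each $m\in\mathfrak M$, $U_m$ is a continuous nondecreasing random utility function on $[a_m,b_m]$ with $U_m(a_m)=0$, and $U(x)=\sum_{m\in\mathfrak M}U_m(x_m)$ is normalized so that $U(a_1,\dots,a_M)=0$ and $U(b_1,\dots,b_M)=1$ almost surely. $\mathfrak X\subseteq[a_1,b_1]\times\cdots\times[a_M,b_M]$ is compact. $\vartheta:=\max_{x\in\mathfrak X}\mathbb{E}[U(x)]$, with set of optimal solutions $X^*$. For each $m$ let $a_m=t_{m,0}<t_{m,1}<\cdots<t_{m,I_m}=b_m$ be breakpoints, $\mathfrak I_m=\{1,\dots,I_m\}$, $I=\sum_mI_m$, and $\Delta:=\max_{m\in\mathfrak M}\max_{i\in\mathfrak I_m}(t_{m,i}-t_{m,i-1})$. It is assumed that the breakpoints are chosen so that $I\to\infty$ ensures $\Delta\to0$. For $v=(v_1^T,\dots,v_M^T)^T\in\mathbb{R}^I$ let $$u_m(x_m;v_m)=\sum_{i\in\mathfrak I_m}\left[\frac{v_{m,i}}{t_{m,i}-t_{m,i-1}}(x_m-t_{m,i-1})+\sum_{j=1}^{i-1}v_{m,j}\right]\mathbf 1\{t_{m,i-1}<x_m\le t_{m,i}\},\qquad u(x;v)=\sum_{m\in\mathfrak M}u_m(x_m;v_m).$$ Let $V_{m,i}:=U_m(t_{m,i})-U_m(t_{m,i-1})$ and let $V\in\mathbb{R}^I$ be the random vector collecting the $V_{m,i}$, so that $u_m(t_{m,i};V_m)=U_m(t_{m,i})$.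 $V^1,\dots,V^N$ is an i.i.d. random sample of $V$ and $\bar V=\frac1N\sum_{n=1}^NV^n$. $\vartheta_{N,I}$ and $X_{N,I}$ denote the optimal value and the set of optimal solutions of $$\max_{x\in\mathfrak X}u(x;\bar V).$$ $\mathrm{Prob}$ refers to the randomness of the sample. $\mathbb D(A,B):=\sup_{a\in A}\inf_{b\in B}\|a-b\|$ is the excess of $A$ over $B$. $O(g)$ denotes a quantity bounded in absolute value by a constant times $|g|$.
   Formalization: The bound N_0 = O(ln δ/ε²) is proved with a constant uniform in ε>0 and in 0<δ≤δ_0 for each δ_0<1 (the constant may depend on δ_0); one constant for all δ is impossible, since ln δ→0 as δ→1. The probability bound itself is proved for all ε, δ>0. *)

(* Defs.v *)
(* MathComp / MathComp-Analysis development. *)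
From HB Require Import structures.
From mathcomp Require Export all_boot all_order all_algebra.
From mathcomp Require Export all_classical all_reals all_analysis.

Set Implicit Arguments.
Unset Strict Implicit.
Unset Printing Implicit Defensive.

Export Order.TTheory GRing.Theory Num.Theory.
Export numFieldNormedType.Exports.

Local Open Scope classical_set_scope.
Local Open Scope ring_scope.

(* The attributes 1, ..., M are indexed by 'I_M and alternatives are row
   vectors of 'rV[R]_M, with m-th coordinate x 0 m. *)

Section Optimization.
Context {R : realType} {M : nat}.
Implicit Types (X A B : set 'rV[R]_M) (f : 'rV[R]_M -> R) (x y : 'rV[R]_M).

(* sup rather than max; the two agree whenever the maximum is attained. *)
Definition optimal_value X f : R := sup (f @` X).

Definition optimal_solutions X f : set 'rV[R]_M :=
  [set x | X x /\ forall y, X y -> f y <= f x].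

(* The norm provided by the library on 'rV[R]_M is the maximum norm. *)
Definition euclidean_norm x : R := Num.sqrt (\sum_m x 0 m ^+ 2).

(* Extended-real valued, hence without side condition on A and B. *)
Definition excess A B : \bar R :=
  ereal_sup [set ereal_inf [set (euclidean_norm (x - y))%:E | y in B]
            | x in A].

End Optimization.

Section RandomUtility.
Context {d : measure_display} {T : measurableType d} {R : realType} {M : nat}.
Implicit Types (P : probability T R) (U : 'I_M -> T -> R -> R).

Definition total_utility U (w : T) (x : 'rV[R]_M) : R :=
  \sum_m U m w (x 0 m).

Definition random_utility P (a b : 'I_M -> R) U : Prop :=
  [/\ forall m x, x \in `[a m, b m] ->
        measurable_fun [set: T] (fun w => U m w x),
      {ae P, forall w, forall m,
        [/\ {within `[a m, b m], continuous (U m w)},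
            {in `[a m, b m] &, {homo U m w : x y / x <= y}} &
            U m w (a m) = 0]} &
      {ae P, forall w, total_utility U w (\row_m a m) = 0 /\
                       total_utility U w (\row_m b m) = 1}].

Definition expected_utility P U (x : 'rV[R]_M) : R :=
  fine ('E_P[fun w => total_utility U w x])%E.

End RandomUtility.

(* nbp g m is I_m, and bp g m i is t_{m,i} for i <= I_m; the values
   bp g m i with i > I_m are irrelevant. *)
Record breakpoints (R : realType) (M : nat) (a b : 'I_M -> R) := Breakpoints {
  nbp : 'I_M -> nat;
  bp : 'I_M -> nat -> R;
  nbp_gt0 : forall m, (0 < nbp m)%N;
  bp_first : forall m, bp m 0%N = a m;
  bp_last : forall m, bp m (nbp m) = b m;
  bp_lt : forall m i, (i < nbp m)%N -> bp m i < bp m i.+1 }.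

Section PiecewiseLinear.
Context {R : realType} {M : nat} {a b : 'I_M -> R}.
Implicit Types (g : breakpoints a b).

Definition total_bp g : nat := (\sum_m nbp g m)%N.

Definition mesh g : R :=
  \big[Num.max/0]_m \big[Num.max/0]_(i < nbp g m) (bp g m i.+1 - bp g m i).

(* The entry v_{m,i+1} of the concatenation v = (v_1^T, ..., v_M^T)^T:
   tagnat.Rank sends (m, i) to the position nbp 0 + ... + nbp (m - 1) + i.
   Below, i : 'I_(nbp g m) likewise stands for the index i + 1. *)
Definition entry g (v : (total_bp g).-tuple R) m (i : 'I_(nbp g m)) : R :=
  tnth v (@tagnat.Rank M (nbp g) m i).

Definition pl_marginal g (v : (total_bp g).-tuple R) (m : 'I_M) (t : R) : R :=
  \sum_(i < nbp g m)
    (entry v i / (bp g m i.+1 - bp g m i) * (t - bp g m i)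
     + \sum_(j < nbp g m | (j < i)%N) entry v j)
    * (bp g m i < t <= bp g m i.+1)%R%:R.

Definition pl_utility g (v : (total_bp g).-tuple R) (x : 'rV[R]_M) : R :=
  \sum_m pl_marginal v m (x 0 m).

Definition increments g {T : Type} (U : 'I_M -> T -> R -> R) (w : T)
    : (total_bp g).-tuple R :=
  [tuple let m := @tagnat.sig1 M (nbp g) s in
         let i := @tagnat.sig2 M (nbp g) s in
         U m w (bp g m i.+1) - U m w (bp g m i) | s < total_bp g].

End PiecewiseLinear.

Section Sampling.
Context {R : realType}.

Definition mutually_independent {d d'} {S : measurableType d}
    {E : measurableType d'} (Prob : probability S R) (X : nat -> S -> E) :=
  forall (J : seq nat) (A : nat -> set E), uniq J ->
    (forall n, measurable (A n)) ->
    Prob (\big[setI/setT]_(n <- J) (X n @^-1` A n)) =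
    (\prod_(n <- J) Prob (X n @^-1` A n))%E.

(* The sample V^1, V^2, ... is X 0, X 1, ...; its underlying probability
   space (S, Prob) need not be the one on which V is defined. *)
Definition iid_sample {d d' d''} {T : measurableType d}
    {S : measurableType d'} {E : measurableType d''}
    (P : probability T R) (V : T -> E)
    (Prob : probability S R) (X : nat -> S -> E) : Prop :=
  [/\ forall n, measurable_fun [set: S] (X n),
      forall n (A : set E), measurable A ->
        pushforward Prob (X n) A = pushforward P V A &
      mutually_independent Prob X].

Definition sample_mean {S : Type} {k : nat} (X : nat -> S -> k.-tuple R)
    (N : nat) (s : S) : k.-tuple R :=
  [tuple N%:R^-1 * \sum_(n < N) tnth (X n s) j | j < k].

Context {M : nat} {a b : 'I_M -> R}.

Definition saa_value (X : set 'rV[R]_M) (g : breakpoints a b) {S : Type}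
    (Vs : nat -> S -> (total_bp g).-tuple R) (N : nat) (s : S) : R :=
  optimal_value X (pl_utility (sample_mean Vs N s)).

Definition saa_solutions (X : set 'rV[R]_M) (g : breakpoints a b) {S : Type}
    (Vs : nat -> S -> (total_bp g).-tuple R) (N : nat) (s : S) :
    set 'rV[R]_M :=
  optimal_solutions X (pl_utility (sample_mean Vs N s)).

End Sampling.

(* N0(eps, delta) = O(ln delta / eps ^ 2), uniformly in eps > 0 and for delta
   bounded away from 1 (the regime of interest being delta -> 0): ln delta
   vanishes at delta = 1, so no bound by a constant multiple of
   |ln delta| / eps ^ 2 can hold as delta -> 1. *)
Definition O_ln_over_sq {R : realType} (N0 : R -> R -> nat) : Prop :=
  forall delta0 : R, 0 < delta0 < 1 ->
    exists C : R, forall eps delta : R, 0 < eps -> 0 < delta <= delta0 ->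
      (N0 eps delta)%:R <= C * `|ln delta / eps ^+ 2|.

(* Main.v *)
Require Import Defs.
From HB Require Import structures.
From mathcomp Require Import ring lra measurable_realfun.

(** Every sampled or interpolated marginal utility is nondecreasing on its
    interval, so its uniform distance to the expected marginal utility is
    controlled by what happens at finitely many points.  If two nondecreasing
    functions differ by at most eta at the points of a grid, and one of them
    rises by at most kappa between consecutive points, then they differ by at
    most eta + kappa everywhere ([monotone_sandwich]).  The expected marginal
    utility of attribute m is Lipschitz with modulus E[L_m], so kappa is at most
    E[L_m] times the mesh of the grid.

    At one grid point x the sampled marginal is the mean of the independent
    identically distributed variables u_m(x; V^n), which lie in [0, 1] almost
    surely, and an exponential Markov inequality gives
    Prob(|mean - expectation| >= eta) <= 2 exp(- N eta^2 / 8)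
    ([tail_two_sided]).  This rests on the multiplicativity of expectations of
    independent variables ([integral_prod_independent]).  The expectation of
    u_m(x; V) is E[U_m(x)] when x is a breakpoint, and within E[L_m] times the
    mesh of it in general.

    The grid on which monotonicity is exploited need not be the set of
    breakpoints that defines V, and [deviation_tail] keeps the two apart.  For
    fixed breakpoints both coincide: the interpolation bias vanishes on the grid,
    half of the tolerance pays for the mesh, a quarter for the sampling error,
    and the last quarter makes the inequality strict.  For consistency the grid
    is frozen at one sufficiently fine set of breakpoints while those defining V
    keep being refined: the union bound then runs over a number of points that
    does not grow, and the resulting estimate is uniform in I.

    Uniform closeness of the objectives gives closeness of the optimal values at
    once.  For the solutions, expected utility is continuous, so on the compact
    set of alternatives at distance at least eps from every true solution it stays
    below the optimum by a positive gap; no such alternative can be optimal for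
    an objective within a third of that gap.

    All these bounds presuppose measurable events.  The supremum over a compact
    set of continuous random functions is measurable as a supremum over a
    countable union of finite nets ([measurable_sup_compact]), and the event that
    the excess is at least eps compares two such suprema
    ([measurable_excess_event]). *)

Set Implicit Arguments.
Unset Strict Implicit.
Unset Printing Implicit Defensive.

Local Open Scope classical_set_scope.
Local Open Scope ring_scope.

(** * Expectations of products of independent variables *)

Section ProductExpectation.
Context {d d'} {S : measurableType d} {E : measurableType d'} {R : realType}.
Variable Prob : probability S R.
Local Open Scope ereal_scope.
Import HBNNSimple.

(** The hypothesis says that Y is independent of the weight W, with c playing the
    role of the integral of W; by linearity it passes from indicators to simple
    functions. *)
Lemma integral_nnsfun_weight (Y : S -> E) (W : S -> R) (c : \bar R)
    (g : {nnsfun E >-> R}) :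
  measurable_fun [set: S] Y -> measurable_fun [set: S] W ->
  (forall s, 0 <= W s)%R -> 0 <= c ->
  (forall A, measurable A ->
     \int[Prob]_s (\1_A (Y s) * W s)%:E = Prob (Y @^-1` A) * c) ->
  \int[Prob]_s (g (Y s) * W s)%:E =
  (\sum_(y \in range g) y%:E * Prob (Y @^-1` (g @^-1` [set y]))) * c.
Proof.
move=> mY mW W0 c0 YW.
have m1 y : measurable_fun [set: S] (fun s => \1_(g @^-1` [set y]) (Y s) : R).
  by apply: measurableT_comp.
have gy0 y x : 0 <= (y * \1_(g @^-1` [set y]) x)%:E by exact: nnfun_muleindic_ge0.
transitivity (\int[Prob]_s (\sum_(y \in range g)
    (y * \1_(g @^-1` [set y]) (Y s))%:E * (W s)%:E)).
  apply: eq_integral => s _.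
  rewrite -ge0_mule_fsuml => [|y]; last exact: gy0.
  by rewrite fsumEFin// -fimfunE EFinM.
rewrite ge0_integral_fsum//; last 2 first.
- move=> y; apply: emeasurable_funM; last exact/measurable_EFinP.
  by apply/measurable_EFinP; apply: measurable_funM.
- by move=> y s _; apply: mule_ge0; [exact: gy0|rewrite lee_fin].
rewrite ge0_mule_fsuml; last first.
  move=> y; have [y0|y0] := leP 0%R y; first by rewrite mule_ge0 ?lee_fin.
  by rewrite preimage_nnfun0// preimage_set0 measure0 mule0.
apply: eq_fsbigr => y _.
have [y0|y0] := leP 0%R y; last first.
  rewrite preimage_nnfun0// preimage_set0 measure0 mule0 mul0e.
  by apply: integral0_eq => s _; rewrite indicE in_set0 mulr0 mul0e.
rewrite -muleA -YW// -ge0_integralZl_EFin//.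
- by apply: eq_integral => s _; rewrite EFinM EFinM muleA.
- by move=> s _; rewrite lee_fin mulr_ge0.
- by apply/measurable_EFinP; apply: measurable_funM.
Qed.

(** Monotone convergence along simple approximations of [phi], on both sides of
    the equality; the finiteness of [c] makes multiplication by it continuous. *)
Lemma integral_comp_weight (Y : S -> E) (W : S -> R) (c : R) (phi : E -> R) :
  measurable_fun [set: S] Y -> measurable_fun [set: S] W ->
  (forall s, 0 <= W s)%R -> (0 <= c)%R ->
  (forall A, measurable A ->
     \int[Prob]_s (\1_A (Y s) * W s)%:E = Prob (Y @^-1` A) * c%:E) ->
  measurable_fun [set: E] phi -> (forall x, 0 <= phi x)%R ->
  \int[Prob]_s (phi (Y s) * W s)%:E =
  \int[Prob]_s (phi (Y s))%:E * c%:E.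
Proof.
move=> mY mW W0 c0 YW mphi phi0.
have mphiE : measurable_fun [set: E] (EFin \o phi) by exact/measurable_EFinP.
pose g := nnsfun_approx measurableT mphiE.
have cg x : EFin \o g ^~ x @ \oo --> (phi x)%:E.
  by apply: (cvg_nnsfun_approx measurableT mphiE) => // y _; rewrite lee_fin.
have ndg x m n : (m <= n)%N -> (g m x <= g n x)%R.
  by move=> mn; exact/lefP/nd_nnsfun_approx.
have cvgW (V : S -> R) : measurable_fun [set: S] V -> (forall s, 0 <= V s)%R ->
    \int[Prob]_s (g n (Y s) * V s)%:E @[n --> \oo] -->
    \int[Prob]_s (phi (Y s) * V s)%:E.
  move=> mV V0.
  have limE s : (phi (Y s) * V s)%:E = limn (fun n => (g n (Y s) * V s)%:E).
    apply/esym/cvg_lim => //; under eq_fun do rewrite EFinM.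
    by rewrite EFinM; apply: cvgeZr => //; exact: cg.
  under [X in _ --> X]eq_integral do rewrite limE.
  apply: (cvg_monotone_convergence measurableT) => //.
  - move=> n; apply/measurable_EFinP; apply: measurable_funM => //.
    by apply: measurableT_comp.
  - by move=> n s _; rewrite lee_fin mulr_ge0.
  - by move=> s _ m n mn; rewrite lee_fin ler_wpM2r ?ndg.
have c1 := cvgW _ mW W0.
have c2 : \int[Prob]_s (g n (Y s) * W s)%:E @[n --> \oo] -->
    \int[Prob]_s (phi (Y s))%:E * c%:E.
  under eq_fun do rewrite (integral_nnsfun_weight _ mY mW W0 _ YW)//.
  apply: cvgeZr => //.
  have := cvgW (cst 1%R) (measurable_cst _) (fun=> ler01).
  under [in X in _ --> X -> _]eq_integral do rewrite mulr1.
  apply: cvg_trans; apply: near_eq_cvg; apply: nearW => n.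
  rewrite (@integral_nnsfun_weight Y (cst 1%R) 1 (g n)) ?mule1//.
  move=> A mA; under eq_integral do rewrite mulr1.
  rewrite mule1 -(setIT (Y @^-1` A)) -integral_indic//.
    by rewrite -[Y @^-1` A]setTI; exact: mY.
exact: (cvg_unique _ c1 c2).
Qed.

Lemma prod_indic (N : nat) (A : nat -> set E) (Y : nat -> S -> E) s :
  (\prod_(n <- iota 0 N) \1_(A n) (Y n s) =
  \1_(\big[setI/setT]_(n <- iota 0 N) (Y n @^-1` A n)) s :> R)%R.
Proof.
elim: (iota 0 N) => [|n r ih]; first by rewrite !big_nil indicT.
by rewrite !big_cons ih indicI.
Qed.

(** Independence is the case where every [phi n] is an indicator.  The indicators
    are traded for general functions one index at a time, the other factors being
    the weight of [integral_comp_weight]. *)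
Lemma integral_prod_independent (Y : nat -> S -> E) (N : nat)
    (phi : nat -> E -> R) :
  (forall n, measurable_fun [set: S] (Y n)) -> mutually_independent Prob Y ->
  (forall n, measurable_fun [set: E] (phi n)) ->
  (forall n x, 0 <= phi n x)%R ->
  (forall n, \int[Prob]_s (phi n (Y n s))%:E < +oo) ->
  \int[Prob]_s (\prod_(n <- iota 0 N) phi n (Y n s))%:E =
  \prod_(n <- iota 0 N) \int[Prob]_s (phi n (Y n s))%:E.
Proof.
move=> mY indep mphi0 phi00 phioo0.
have iotaN n : n \in iota 0 N = (n < N)%N by rewrite mem_iota.
(* Induction on the number k of leading factors that are not indicators. *)
suff H k : forall psi : nat -> E -> R,
    (forall n, measurable_fun [set: E] (psi n)) ->
    (forall n x, 0 <= psi n x)%R ->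
    (forall n, \int[Prob]_s (psi n (Y n s))%:E < +oo) ->
    (forall n, (k <= n < N)%N -> exists2 A, measurable A & psi n = \1_A) ->
    \int[Prob]_s (\prod_(n <- iota 0 N) psi n (Y n s))%:E =
    \prod_(n <- iota 0 N) \int[Prob]_s (psi n (Y n s))%:E.
  by apply: (H N) => // n; rewrite ltnNge; case: leqP.
move: phi mphi0 phi00 phioo0 => _ _ _ _.
have mpre n A : measurable A -> measurable (Y n @^-1` A).
  by move=> mA; rewrite -[_ @^-1` _]setTI; exact: mY.
have intI n A : measurable A ->
    \int[Prob]_s (\1_A (Y n s))%:E = Prob (Y n @^-1` A).
  by move=> mA; rewrite -(setIT (_ @^-1` _)) -integral_indic//; exact: mpre.
elim: k => [|k ih] psi mpsi psi0 psioo psi1.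
  have /choice[A hA] n : exists A, measurable A /\ ((n < N)%N -> psi n = \1_A).
    have [nN|nN] := ltnP n N; last by exists setT.
    by have [A mA pA] := psi1 _ nN; exists A.
  rewrite [RHS](eq_big_seq (fun n => Prob (Y n @^-1` A n))); last first.
    move=> n; rewrite iotaN => nN; have [mA ->//] := hA n; exact: intI.
  have mA n : measurable (A n) by have [] := hA n.
  rewrite -indep ?iota_uniq//.
  rewrite -[X in Prob X]setIT -integral_indic//; last first.
    by elim: (iota 0 N) => [|n r ihr]; rewrite ?big_nil ?big_cons//;
      apply: measurableI => //; apply: mpre.
  apply: eq_integral => s _; rewrite -prod_indic; congr (_%:E).
  by apply: eq_big_seq => n; rewrite iotaN => nN; have [_ ->] := hA n.
have [Nk|kN] := leqP N k.
  apply: ih => // n /andP[kn nN]; have := leq_ltn_trans kn nN.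
  by rewrite ltnNge Nk.
have kI : k \in iota 0 N by rewrite iotaN.
have uI := iota_uniq 0 N.
pose W s := (\prod_(n <- iota 0 N | n != k) psi n (Y n s))%R.
pose c := \prod_(n <- iota 0 N | n != k) \int[Prob]_s (psi n (Y n s))%:E.
have c0 : 0 <= c.
  by apply: prode_ge0 => n _; apply: integral_ge0 => s _; rewrite lee_fin.
have cfin : c \is a fin_num.
  apply: (big_ind (fun x : \bar R => x \is a fin_num)) => // [x y|n _].
    exact: fin_numM.
  rewrite ge0_fin_numE//; apply: integral_ge0 => s _; rewrite lee_fin//.
rewrite (bigD1_seq k)//= -/c -(fineK cfin).
rewrite -(@integral_comp_weight (Y k) W)//.
- by apply: eq_integral => s _; rewrite (bigD1_seq k).
- rewrite /W; under eq_fun do rewrite -big_filter.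
  by apply: measurable_prod => n _; apply: measurableT_comp.
- by move=> s; rewrite prodr_ge0.
- exact: fine_ge0.
move=> A mA; rewrite fineK//.
pose psi' n := if n == k then \1_A else psi n.
have psi'k : psi' k = \1_A by rewrite /psi' eqxx.
have psi'n n : n != k -> psi' n = psi n by rewrite /psi' => /negbTE ->.
have := ih psi'.
rewrite (bigD1_seq k)//= psi'k intI//.
rewrite (eq_bigr (fun n => \int[Prob]_s (psi n (Y n s))%:E)); last first.
  by move=> n nk; rewrite psi'n.
move=> <-.
- apply: eq_integral => s _; rewrite (bigD1_seq k)//= psi'k; congr (_ * _)%:E.
  by apply: eq_bigr => n nk; rewrite psi'n.
- by move=> n; rewrite /psi'; case: ifP.
- by move=> n x; rewrite /psi'; case: ifP.
- move=> n; rewrite /psi'; case: ifP => [/eqP ->|//].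
  by rewrite intI// (le_lt_trans (probability_le1 _ _)) ?ltry//; exact: mpre.
- move=> n /andP[kn nN]; have [->|nk] := eqVneq n k.
    by exists A.
  rewrite psi'n//; apply: psi1; by rewrite nN ltn_neqAle eq_sym nk kn.
Qed.

End ProductExpectation.

(** * An exponential tail bound for sample means *)

(** Since exp(-t) >= 1 - t, exp(t) is at most 1 / (1 - t). *)
Lemma expR_le_quadratic (R : realType) (t : R) :
  t <= 2^-1 -> expR t <= 1 + t + 2 * t ^+ 2.
Proof.
move=> t2; have := expR_ge1Dx (- t); rewrite expRN => h.
have t1 : 0 < 1 - t by lra.
have : expR t <= (1 - t)^-1.
  by rewrite -[expR t]invrK lef_pV2 ?posrE ?invr_gt0 ?expR_gt0.
move/le_trans; apply.
rewrite -[leLHS]mul1r ler_pdivrMr//.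
have : 0 <= t ^+ 2 * (1 - 2 * t) by rewrite mulr_ge0 ?sqr_ge0//; lra.
by rewrite expr2; nra.
Qed.

(** On [0, 1] the convex function z |-> exp(t z) lies below its chord. *)
Lemma expR_le_chord (R : realType) (t z : R) :
  0 <= z <= 1 -> expR (t * z) <= 1 + z * (expR t - 1).
Proof.
move=> /andP[z0 z1].
have := @convex_expR R (Itv01 z0 z1) t 0.
rewrite !convRE/= mulr0 addr0 expR0 mulr1 mulrC /unstable.onem => /le_trans; apply.
by rewrite le_eqVlt; apply/orP; left; apply/eqP; ring.
Qed.

Lemma measurable_set_ge (R : realType) d (S : measurableType d) (f g : S -> R) :
  measurable_fun [set: S] f -> measurable_fun [set: S] g ->
  measurable [set s | f s <= g s].
Proof.
move=> mf mg.
have := measurable_fun_ler mf mg measurableT (I : measurable [set true]).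
by rewrite setTI; congr measurable; apply/seteqP; split.
Qed.

Lemma measure_le_setU d (S : measurableType d) (R : realType)
    (P : probability S R) (A B C : set S) :
  measurable A -> measurable B -> measurable C -> A `<=` B `|` C ->
  (P A <= P B + P C)%E.
Proof.
move=> mA mB mC ABC; have := @content_subadditive _ _ _ P A (bigcup2 B C) 2.
rewrite bigsetU_bigcup2 !big_ord_recr/= big_ord0 add0e; apply => //.
by move=> [|[|[|]]].
Qed.

Lemma measure_le_bigsetU d (S : measurableType d) (R : realType)
    (P : probability S R) (I : Type) (r : seq I) (A : set S) (F : I -> set S) :
  measurable A -> (forall i, measurable (F i)) ->
  A `<=` \big[setU/set0]_(i <- r) F i -> (P A <= \sum_(i <- r) P (F i))%E.
Proof.
move=> mA mF AF.
have mU s : measurable (\big[setU/set0]_(i <- s) F i).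
  by apply: bigsetU_measurable.
apply: (@le_trans _ _ (P (\big[setU/set0]_(i <- r) F i))).
  by apply: le_measure; rewrite ?inE.
elim: r {AF} => [|i r ih]; first by rewrite !big_nil measure0.
rewrite !big_cons; apply: le_trans (leeD (lexx _) ih).
by apply: measure_le_setU => //; exact: measurableU.
Qed.

Section Tail.
Context {d} {S : measurableType d} {R : realType}.
Variable Prob : probability S R.
Variables (Z : nat -> S -> R) (mu : R).
Hypothesis mZ : forall n, measurable_fun [set: S] (Z n).
Hypothesis indepZ : mutually_independent Prob Z.
Hypothesis mu01 : 0 <= mu <= 1.
Hypothesis mgfZ : forall n t,
  (\int[Prob]_s (expR (t * Z n s))%:E <= (1 + mu * (expR t - 1))%:E)%E.

(** Chernoff bound.  A positive t gives the upper tail and a negative t the lower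
    one.  The hypothesis on the moment generating function is
    E[exp(t Z)] <= 1 + mu (exp t - 1) <= exp(mu (t + 2 t^2)). *)
Lemma tail_one_sided (N : nat) (t eta : R) : t <= 2^-1 ->
  (Prob [set s | (t * (N%:R * mu) + `|t| * (N%:R * eta) <= t * \sum_(n < N) Z n s)%R]
   <= (expR (N%:R * (2 * t ^+ 2 - `|t| * eta)))%:E)%E.
Proof.
move=> t2.
pose W s := t * \sum_(n < N) Z n s.
have mW : measurable_fun [set: S] W.
  by apply: measurable_funM => //; apply: measurable_sum.
pose W' : {RV Prob >-> R} := HB.pack W (isMeasurableFun.Build _ _ _ _ _ mW).
have := @chernoff _ _ _ Prob W' 1 (t * (N%:R * mu) + `|t| * (N%:R * eta)) ltr01.
move=> /le_trans; apply.
rewrite /mmt_gen_fun unlock mul1r.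
have -> : (\int[Prob]_w ((expR \o 1 \o* W') w)%:E =
    \prod_(n <- iota 0 N) \int[Prob]_s (expR (t * Z n s))%:E)%E.
  rewrite -(@integral_prod_independent _ _ _ _ _ Prob Z N (fun n z => expR (t * z)))//.
  - apply: eq_integral => s _ /=; rewrite mulr1 /W mulr_sumr expR_sum.
    by rewrite -(big_mkord xpredT (fun n => expR (t * Z n s))) /index_iota subn0.
  - by move=> n; apply: measurableT_comp => //; apply: measurable_funM.
  - by move=> n; apply: (le_lt_trans (mgfZ n t)); rewrite ltry.
have : (\prod_(n <- iota 0 N) \int[Prob]_s (expR (t * Z n s))%:E
   <= (expR (N%:R * (mu * t + 2 * t ^+ 2)))%:E)%E.
  rewrite -{2}(size_iota 0 N).
  elim: (iota 0 N) => [|n r ih]; first by rewrite big_nil mul0r expR0.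
  rewrite big_cons/= -addn1 natrD addrC mulrDl mul1r expRD EFinM.
  apply: lee_pmul => //.
  - by apply: integral_ge0 => s _; rewrite lee_fin expR_ge0.
  - by apply: prode_ge0 => m _; apply: integral_ge0 => s _; rewrite lee_fin expR_ge0.
  apply: (le_trans (mgfZ n t)); rewrite lee_fin.
  apply: (le_trans (expR_ge1Dx _)); rewrite ler_expR.
  move: mu01 => /andP[m0 m1].
  have h := expR_le_quadratic t2.
  have h1 : mu * (expR t - 1) <= mu * (t + 2 * t ^+ 2) by rewrite ler_wpM2l//; lra.
  apply: (le_trans h1); rewrite mulrDr lerD2l.
  by rewrite ler_piMl// mulr_ge0// sqr_ge0.
move=> h; apply: (le_trans (lee_wpmul2r _ h)); first by rewrite lee_fin expR_ge0.
rewrite -EFinM lee_fin -expRD ler_expR.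
by rewrite le_eqVlt; apply/orP; left; apply/eqP; ring.
Qed.

Lemma tail_two_sided (N : nat) (eta : R) : 0 < eta <= 1 ->
  (Prob [set s | (eta <= `|N%:R^-1 * \sum_(n < N) Z n s - mu|)%R]
   <= (2 * expR (- (N%:R * eta ^+ 2 / 8)))%:E)%E.
Proof.
move=> /andP[e0 e1].
have mmean : measurable_fun [set: S] (fun s => N%:R^-1 * \sum_(n < N) Z n s - mu).
  by apply: measurable_funB => //; apply: measurable_funM => //; apply: measurable_sum.
have mevent : measurable [set s | eta <= `|N%:R^-1 * \sum_(n < N) Z n s - mu|].
  by apply: measurable_set_ge => //; apply: measurableT_comp.
have [N0|N0] := posnP N.
  apply: (le_trans (probability_le1 Prob mevent)).
  by rewrite N0 lee_fin mul0r mul0r oppr0 expR0 mulr1 ler1n.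
have mdev (t c : R) : measurable [set s | c <= t * \sum_(n < N) Z n s].
  by apply: measurable_set_ge => //; apply: measurable_funM => //; apply: measurable_sum.
(* This t minimizes the exponent 2 t^2 - t eta of the one-sided bounds. *)
pose t := eta / 4.
have t0 : 0 < t by rewrite divr_gt0.
have b1 := @tail_one_sided N t eta ltac:(rewrite /t; lra).
have b2 := @tail_one_sided N (- t) eta ltac:(rewrite /t; lra).
have E : N%:R * (2 * t ^+ 2 - t * eta) = - (N%:R * eta ^+ 2 / 8).
  by rewrite /t !expr2; field.
rewrite sqrrN normrN gtr0_norm// E in b2; rewrite gtr0_norm// E in b1.
rewrite mulr_natl mulr2n EFinD.
apply: le_trans (leeD b1 b2).
apply: measure_le_setU => // s /= h.
have NR : 0 < (N%:R : R) by rewrite ltr0n.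
have {h} : N%:R * eta <= `|\sum_(n < N) Z n s - N%:R * mu|.
  rewrite -[X in `|X|](_ : N%:R * (N%:R^-1 * \sum_(n < N) Z n s - mu) = _).
    by rewrite normrM gtr0_norm// ler_pM2l.
  by rewrite mulrBr mulrA divff ?mul1r// gt_eqF.
rewrite ler_normr => /orP[h|h]; [left|right] => /=.
  by rewrite -mulrDr ler_pM2l// addrC -lerBrDr.
by have := ler_wpM2l (ltW t0) h; lra.
Qed.
End Tail.

(** * Piecewise linear interpolation *)

Section Ramp.
Context {R : realType}.
Implicit Types s t x y : R.

(** The weight of the increment over [s, t] in the value at x of a piecewise
    linear function. *)
Definition ramp s t x : R := Num.max 0 (Num.min 1 ((x - s) / (t - s))).

Lemma ramp_ge0 s t x : 0 <= ramp s t x.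
Proof. by rewrite /ramp le_max lexx. Qed.

Lemma ramp_le1 s t x : ramp s t x <= 1.
Proof. by rewrite /ramp ge_max ler01 ge_min lexx. Qed.

Lemma ramp_homo s t : s < t -> {homo ramp s t : x y / x <= y}.
Proof.
move=> st x y xy; rewrite /ramp; apply: le_max2 => //; apply: le_min2 => //.
by rewrite ler_pM2r ?invr_gt0 ?subr_gt0// lerB.
Qed.

Lemma ramp0 s t x : s < t -> x <= s -> ramp s t x = 0.
Proof.
move=> st xs; apply/max_idPl; rewrite ge_min; apply/orP; right.
by rewrite pmulr_lle0 ?invr_gt0 ?subr_gt0// subr_le0.
Qed.

Lemma ramp1 s t x : s < t -> t <= x -> ramp s t x = 1.
Proof.
move=> st tx; rewrite /ramp min_l ?max_r//.
by rewrite ler_pdivlMr ?subr_gt0// mul1r lerB.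
Qed.

Lemma ramp_mid s t x : s < x <= t -> ramp s t x = (x - s) / (t - s).
Proof.
move=> /andP[sx xt]; have st := lt_le_trans sx xt.
rewrite /ramp min_r ?max_r//.
  by rewrite divr_ge0// subr_ge0 ltW.
by rewrite ler_pdivrMr ?subr_gt0// mul1r lerB.
Qed.

Lemma continuous_ramp s t : continuous (ramp s t).
Proof.
have -> : ramp s t = cst 0 \max (cst 1 \min (fun x => (x - s) / (t - s))) by [].
move=> x; apply: continuous_max; first exact: cvg_cst.
apply: continuous_min; first exact: cvg_cst.
by apply: cvgMr_tmp; apply: cvgB; [exact: cvg_id|exact: cvg_cst].
Qed.

End Ramp.

Section PiecewiseLinearTheory.
Context {R : realType} {M : nat} {a b : 'I_M -> R} (g : breakpoints a b).
Implicit Types (m : 'I_M) (v : (total_bp g).-tuple R).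

Lemma bp_le m i j : (i <= j <= nbp g m)%N -> bp g m i <= bp g m j.
Proof.
elim: j => [|j ih] /andP[]; first by rewrite leqn0 => /eqP ->.
rewrite leq_eqVlt => /predU1P[->//|ij] jn.
by rewrite (le_trans (ih _)) ?ltW ?bp_lt// -ltnS ij/= ltnW.
Qed.

Lemma lower_lt_upper m : a m < b m.
Proof.
rewrite -(bp_first g) -(bp_last g).
have n0 := nbp_gt0 g m.
by rewrite (lt_le_trans (bp_lt n0))// bp_le// n0 leqnn.
Qed.

Lemma bp_itv m i : (i <= nbp g m)%N -> bp g m i \in `[a m, b m].
Proof.
by move=> ?; rewrite in_itv/= -(bp_first g) -(bp_last g) !bp_le ?leqnn ?andbT.
Qed.

Lemma bp_locate m x : x \in `[a m, b m] ->
  x = a m \/ exists i : 'I_(nbp g m), bp g m i < x <= bp g m i.+1.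
Proof.
rewrite in_itv/= -(bp_last g m) -(bp_first g m) => /andP[ax].
have := leqnn (nbp g m); move: {1 3}(nbp g m) => k.
elim: k => [|k ih] kn xk; first by left; apply/eqP; rewrite eq_le xk.
have [xk'|kx] := leP x (bp g m k); first by apply: ih => //; exact: ltnW.
by right; exists (Ordinal kn); rewrite /= kx.
Qed.

(** The indicators of half-open intervals in the definition hide that the marginal
    is continuous in x, and nondecreasing when v is nonnegative; as a combination
    of ramps it is manifestly both. *)
Lemma pl_marginalE v m x : x \in `[a m, b m] ->
  pl_marginal v m x =
  \sum_(i < nbp g m) ramp (bp g m i) (bp g m i.+1) x * entry v i.
Proof.
move=> /bp_locate[->|[k /andP[kx xk]]].
  rewrite /pl_marginal !big1// => i _.
    rewrite ramp0 ?mul0r ?bp_lt// -(bp_first g) bp_le//= ltnW//.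
  rewrite (_ : _ < _ = false) ?mulr0//; apply/negbTE; rewrite -leNgt.
  by rewrite -(bp_first g) bp_le//= ltnW.
have lo (i : 'I_(nbp g m)) : (i < k)%N -> bp g m i.+1 < x.
  by move=> ik; rewrite (le_lt_trans _ kx)// bp_le// ik/= ltnW.
have hi (i : 'I_(nbp g m)) : (k < i)%N -> x <= bp g m i.
  by move=> ki; rewrite (le_trans xk)// bp_le// ki/= ltnW.
rewrite /pl_marginal (bigD1 k)//= [X in _ + X]big1 ?addr0; last first.
  move=> i; rewrite neq_ltn => /orP[ik|ki].
    by rewrite [X in _ && X]leNgt lo// andbF mulr0.
  by rewrite ltNge hi// mulr0.
rewrite kx xk mulr1 [RHS](bigID (fun i : 'I_(nbp g m) => (i < k)%N))/= [RHS]addrC.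
congr (_ + _); last first.
  by apply: eq_bigr => i ik; rewrite ramp1 ?mul1r ?bp_lt// ltW ?lo.
rewrite (bigD1 k)/= ?ltnn// big1 ?addr0.
  by rewrite ramp_mid ?kx// mulrAC [RHS]mulrC mulrA.
move=> i /andP[]; rewrite -leqNgt leq_eqVlt eq_sym => /orP[/eqP/val_inj ->|ki _].
  by rewrite eqxx.
by rewrite ramp0 ?mul0r ?hi// bp_lt.
Qed.

Lemma pl_marginal_bp v m k : (k <= nbp g m)%N ->
  pl_marginal v m (bp g m k) = \sum_(i < nbp g m | (i < k)%N) entry v i.
Proof.
move=> kn; rewrite pl_marginalE ?bp_itv// [RHS]big_mkcond/=.
apply: eq_bigr => i _; case: ltnP => ik.
  by rewrite ramp1 ?mul1r ?bp_lt// bp_le// ik.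
by rewrite ramp0 ?mul0r ?bp_lt// bp_le// ik ltnW.
Qed.

Lemma entry_increments (T : Type) (U : 'I_M -> T -> R -> R) w m
    (i : 'I_(nbp g m)) :
  entry (increments g U w) i = U m w (bp g m i.+1) - U m w (bp g m i).
Proof.
by rewrite /entry tnth_mktuple tagnat.Rank2K/= tagnat.Rank1K.
Qed.

Lemma pl_marginal_increments (T : Type) (U : 'I_M -> T -> R -> R) w m k :
  (k <= nbp g m)%N ->
  pl_marginal (increments g U w) m (bp g m k) = U m w (bp g m k) - U m w (a m).
Proof.
move=> kn; rewrite pl_marginal_bp//.
under eq_bigr do rewrite entry_increments.
rewrite -(big_ord_widen _ (fun i => U m w (bp g m i.+1) - U m w (bp g m i)) kn).
by rewrite -(big_mkord xpredT (fun i => U m w (bp g m i.+1) - U m w (bp g m i)))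
  telescope_sumr// (bp_first g).
Qed.

Lemma pl_marginal_homo v m : (forall i : 'I_(nbp g m), 0 <= entry v i) ->
  {in `[a m, b m] &, {homo pl_marginal v m : x y / x <= y}}.
Proof.
move=> v0 x y xI yI xy; rewrite !pl_marginalE//.
by apply: ler_sum => i _; rewrite ler_wpM2r// ramp_homo ?bp_lt.
Qed.

Lemma pl_marginal_itv v m x : (forall i : 'I_(nbp g m), 0 <= entry v i) ->
  x \in `[a m, b m] ->
  0 <= pl_marginal v m x <= \sum_(i < nbp g m) entry v i.
Proof.
move=> v0 xI; rewrite pl_marginalE// sumr_ge0/=; last first.
  by move=> i _; rewrite mulr_ge0 ?ramp_ge0.
by apply: ler_sum => i _; rewrite ler_piMl ?ramp_le1.
Qed.

Lemma step_le_mesh m (i : 'I_(nbp g m)) : bp g m i.+1 - bp g m i <= mesh g.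
Proof.
rewrite /mesh.
apply: le_trans (le_bigmax _ (fun m => \big[Num.max/0]_(i < nbp g m) (bp g m i.+1 - bp g m i)) m).
exact: (le_bigmax _ (fun i : 'I_(nbp g m) => bp g m i.+1 - bp g m i) i).
Qed.

Lemma mesh_ge0 : 0 <= mesh g.
Proof. by rewrite /mesh; exact: bigmax_ge_id. Qed.

(** Between two grid points, both functions are caught between their values at
    these points. *)
Lemma monotone_sandwich m (p q : R -> R) (eta kappa : R) :
  {in `[a m, b m] &, {homo p : x y / x <= y}} ->
  {in `[a m, b m] &, {homo q : x y / x <= y}} ->
  0 <= kappa ->
  (forall i, (i <= nbp g m)%N -> `|p (bp g m i) - q (bp g m i)| <= eta) ->
  (forall i, (i < nbp g m)%N -> q (bp g m i.+1) - q (bp g m i) <= kappa) ->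
  forall x, x \in `[a m, b m] -> `|p x - q x| <= eta + kappa.
Proof.
move=> hp hq k0 pq qk x xI.
have [xa|[i /andP[ix xi]]] := bp_locate xI.
  by rewrite xa -(bp_first g) (le_trans (pq _ _))// lerDl.
have iI := bp_itv (ltnW (ltn_ord i)); have iI1 := bp_itv (ltn_ord i).
have h1 := hp _ _ iI xI (ltW ix); have h2 := hp _ _ xI iI1 xi.
have h3 := hq _ _ iI xI (ltW ix); have h4 := hq _ _ xI iI1 xi.
have := pq _ (ltnW (ltn_ord i)); have := pq _ (ltn_ord i); have := qk _ (ltn_ord i).
rewrite !ler_norml => h5 /andP[h6 h7] /andP[h8 h9].
apply/andP; split; lra.
Qed.

End PiecewiseLinearTheory.

(** * Suprema over compact sets and the excess *)

(** For real-valued functions the supremum of an unbounded set is a default value;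
    an attained bound identifies it. *)
Lemma sup_attained (R : realType) (X : Type) (K : set X) (f : X -> R) x :
  K x -> (forall y, K y -> f y <= f x) -> sup (f @` K) = f x.
Proof.
move=> Kx fx; apply/eqP; rewrite eq_le; apply/andP; split.
  apply: ge_sup; first by exists (f x), x.
  by move=> _ [y Ky <-]; exact: fx.
apply: ub_le_sup; last by exists x.
by exists (f x) => _ [y Ky <-]; exact: fx.
Qed.

Lemma compact_sup_attained (R : realType) (X : topologicalType) (K : set X)
    (f : X -> R) : compact K -> K !=set0 -> {within K, continuous f} ->
  exists x, [/\ K x, forall y, K y -> f y <= f x & sup (f @` K) = f x].
Proof.
move=> cK K0 cf; have [x /set_mem Kx xmax] := compact_EVT_max K0 cK cf.
have {}xmax y : K y -> f y <= f x by move=> Ky; apply: xmax; exact: mem_set.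
by exists x; split => //; exact: sup_attained.
Qed.

(** The property of being covered by the balls around D is preserved when D grows,
    so compactness applies to the filter of large finite subsets. *)
Lemma compact_finite_net (R : realType) (X : pseudoMetricType R) (K : set X)
    (e : R) : compact K -> 0 < e ->
  exists D : set X, [/\ finite_set D, D `<=` K & K `<=` \bigcup_(x in D) ball x e].
Proof.
move=> cK e0.
pose net (D : set X) := finite_set D /\ D `<=` K.
pose F : set_system (set X) := [set Q | exists2 D0, net D0 &
  forall D, net D -> D0 `<=` D -> Q D].
have FF : Filter F.
  split.
  - by exists set0 => //; split.
  - move=> Q Q' [D0 [fD KD] QD] [D0' [fD' KD'] QD'].
    exists (D0 `|` D0'); first by split; [rewrite finite_setU|rewrite subUset].
    by move=> D nD; rewrite subUset => -[? ?]; split; [exact: QD|exact: QD'].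
  - by move=> Q Q' QQ' [D0 nD0 QD]; exists D0 => // D nD D0D; apply: QQ'; exact: QD.
have [D0 nD0 D0K] : \forall D \near F, K `<=` [set x | exists2 y, D y & ball y e x].
  apply: ((compact_near_coveringP K).1 cK _ F (fun D x => exists2 y, D y & ball y e x)).
  move=> x Kx; exists (ball x e, [set D | D x]) => /=.
    split; first exact: nbhsx_ballx.
    exists [set x]; first by split => // _ ->.
    by move=> D _; apply.
  by move=> [x' D] /= [xx' Dx]; exists x.
have [fD DK] := nD0.
by exists D0; split => // x Kx; exact: (D0K D0 nD0 _ x Kx).
Qed.

(** If F s exceeds c somewhere on K, then by continuity it does so at a point of
    a sufficiently fine finite net, and these nets are countably many. *)
Lemma measurable_sup_compact (R : realType) d (S : measurableType d)
    (X : pseudoMetricType R) (K : set X) (F : S -> X -> R) :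
  compact K -> K !=set0 -> (forall s, continuous (F s)) ->
  (forall x, K x -> measurable_fun [set: S] (F ^~ x)) ->
  measurable_fun [set: S] (fun s => sup (F s @` K)).
Proof.
move=> cK K0 cF mF.
have /choice[D hD] (n : nat) : exists D : set X,
    [/\ finite_set D, D `<=` K & K `<=` \bigcup_(x in D) ball x n.+1%:R^-1].
  by apply: compact_finite_net; rewrite ?invr_gt0.
move=> mT; apply: (measurability _ (RGenOInfty.measurableE R)) => //.
move=> _ [_ [c ->] <-]; rewrite setTI.
have -> : (fun s => sup (F s @` K)) @^-1` `]c, +oo[ =
    \bigcup_n \bigcup_(x in D n) [set s | c < F s x].
  apply/seteqP; split => s /=; rewrite in_itv/= andbT.
    have [x [Kx _ ->]] := compact_sup_attained cK K0 (continuous_subspaceT (cF s)).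
    move=> cx.
    have : \forall y \near x, c < F s y.
      exact: cvgr_gt (cF s x) _ cx.
    move=> /nbhs_ballP[e/= e0 xe].
    have [n _ /(_ n (leqnn n))/= ne] := near_infty_natSinv_lt (PosNum e0).
    have [_ _ /(_ x Kx)[y Dy xy]] := hD n.
    exists n => //; exists y => //; apply: xe; apply: ball_sym.
    exact: le_ball (ltW ne) _ xy.
  move=> [n _ [x Dx /= cx]]; apply: (lt_le_trans cx).
  have Kx : K x by have [_ + _] := hD n; exact.
  have [z [_ zmax ->]] := compact_sup_attained cK K0 (continuous_subspaceT (cF s)).
  exact: zmax.
apply: bigcup_measurable => n _.
have [fD DK _] := hD n.
apply: fin_bigcup_measurable => // x Dx.
rewrite (_ : [set s | c < F s x] = F ^~ x @^-1` `]c, +oo[); last first.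
  by apply/seteqP; split => s /=; rewrite in_itv/= andbT.
rewrite -[X in measurable X]setTI; exact: (mF _ (DK _ Dx)).
Qed.

Section Excess.
Context {R : realType} {M : nat}.
Implicit Types (A B : set 'rV[R]_M).

Lemma continuous_euclidean_distance (y : 'rV[R]_M) :
  continuous (fun x : 'rV[R]_M => euclidean_norm (x - y)).
Proof.
move=> x; apply: (@continuous_comp _ _ _ (fun x : 'rV[R]_M => \sum_m (x - y) 0 m ^+ 2)
  (@Num.sqrt R)); last exact: sqrt_continuous.
apply: continuous_big => [|m _]; first exact: add_continuous.
move=> z; rewrite /continuous_at; under eq_fun do rewrite !mxE expr2.
have h : x 0 m - y 0 m @[x --> z] --> z 0 m - y 0 m.
  by apply: cvgB; [exact: coord_continuous|exact: cvg_cst].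
rewrite !mxE expr2; exact: (cvgM h h).
Qed.

(** The distance to B is an infimum of continuous functions, hence upper
    semicontinuous, and so its supremum over the compact set A is attained. *)
Lemma excess_geP A B (eps : R) : compact A ->
  (eps%:E <= excess A B)%E <->
  exists2 x, A x & forall y, B y -> eps <= euclidean_norm (x - y).
Proof.
move=> cA; split => [|[x Ax xB]]; last first.
  apply: (@le_trans _ _ (ereal_inf [set (euclidean_norm (x - y))%:E | y in B])).
    by apply: le_ereal_inf_tmp => _ [y By <-]; rewrite lee_fin xB.
  by apply: ereal_sup_ubound; exists x.
move=> le_eps; apply: contrapT => h.
have close x : A x -> exists2 y, B y & euclidean_norm (x - y) < eps.
  move=> Ax; apply: contrapT => hx; apply: h; exists x => // y By.
  by rewrite leNgt; apply/negP => xy; apply: hx; exists y.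
have : \forall q \near eps^'-, A `<=` [set x | exists2 y, B y & euclidean_norm (x - y) <= q].
  apply: ((compact_near_coveringP A).1 cA) => x Ax.
  have [y By xy] := close _ Ax.
  (* The point y that works at x still works, with the larger bound r, near x. *)
  pose r := (euclidean_norm (x - y) + eps) / 2.
  have xr : euclidean_norm (x - y) < r by rewrite /r; lra.
  have re : r < eps by rewrite /r; lra.
  have n1 : \forall x' \near x, euclidean_norm (x' - y) < r.
    exact: cvgr_lt (@continuous_euclidean_distance y x) _ xr.
  have n2 : \forall q \near eps^'-, r < q by exact: nbhs_left_gt.
  near=> x' q => /=; exists y => //; apply: ltW; apply: (@lt_trans _ _ r).
    by near: x'.
  by near: q.
move=> hq; have [q [Aq qe]] : exists q,
    A `<=` [set x | exists2 y, B y & euclidean_norm (x - y) <= q] /\ q < eps.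
  have : \forall q \near eps^'-,
      A `<=` [set x | exists2 y, B y & euclidean_norm (x - y) <= q] /\ q < eps.
    by near=> q; split; near: q => //; exact: nbhs_left_lt.
  by move=> /filter_ex.
have : (excess A B <= q%:E)%E.
  apply: ge_ereal_sup => _ [x Ax <-]; have [y By xy] := Aq _ Ax.
  apply: (@le_trans _ _ (euclidean_norm (x - y))%:E); last by rewrite lee_fin.
  by apply: ereal_inf_lbound; exists y.
move=> /(le_trans le_eps); rewrite lee_fin leNgt; by rewrite qe.
Unshelve. all: by end_near. Qed.

End Excess.

(** * Expectations under almost sure inequalities *)

Section Mean.
Context {d} {T : measurableType d} {R : realType}.
Variable P : probability T R.
Implicit Types (f g : T -> R).

Lemma integrable_ae_abs_le f g : measurable_fun [set: T] f ->
  P.-integrable setT (EFin \o g) -> {ae P, forall w, `|f w| <= g w} ->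
  P.-integrable setT (EFin \o f).
Proof.
move=> mf /integrableP[mg gint] fg.
apply/integrableP; split; first exact/measurable_EFinP.
apply: le_lt_trans gint; apply: ae_ge0_le_integral => //.
- by apply: measurableT_comp => //; exact/measurable_EFinP.
- exact: measurableT_comp.
- by apply: filterS fg => w h _ /=; rewrite lee_fin (le_trans h)// ler_norm.
Qed.

Lemma integrable_ae_itv01 f : measurable_fun [set: T] f ->
  {ae P, forall w, 0 <= f w <= 1} -> P.-integrable setT (EFin \o f).
Proof.
move=> mf f01; apply: (@integrable_ae_abs_le _ (cst 1)) => //.
  exact: finite_measure_integrable_cst.
by apply: filterS f01 => w /andP[f0 f1]; rewrite ger0_norm.
Qed.

(** Almost sure inequalities are used throughout because the utility functions are
    monotone, normalized and Lipschitz only almost surely. *)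
Lemma ae_le_Rintegral f g : P.-integrable setT (EFin \o f) ->
  P.-integrable setT (EFin \o g) -> {ae P, forall w, f w <= g w} ->
  (\int[P]_w f w <= \int[P]_w g w)%R.
Proof.
move=> fi gi [N [mN N0 fgN]].
rewrite /Rintegral (negligible_integral mN _ fi N0)//.
rewrite (negligible_integral mN _ gi N0)//.
have mD : measurable (setT `\` N) by exact: measurableD.
apply: le_Rintegral => //; try by apply: (integrableS measurableT).
by move=> w [_ Nw]; apply: contrapT => h; apply: Nw; exact: fgN.
Qed.

Lemma Rintegral_cst_probability (c : R) : (\int[P]_w c = c)%R.
Proof. by rewrite Rintegral_cst// (congr1 fine (probability_setT P)) mulr1. Qed.

Lemma Rintegral_sum (I : Type) (r : seq I) (f : I -> T -> R) :
  (forall i, P.-integrable setT (EFin \o f i)) ->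
  P.-integrable setT (EFin \o (fun w => \sum_(i <- r) f i w)) /\
  (\int[P]_w (\sum_(i <- r) f i w) = \sum_(i <- r) \int[P]_w f i w)%R.
Proof.
move=> fi; elim: r => [|i r [ih1 ih2]].
  split.
    under eq_fun do rewrite big_nil; exact: finite_measure_integrable_cst.
  rewrite big_nil; under eq_Rintegral do rewrite big_nil.
  exact: Rintegral_cst_probability.
split.
  under eq_fun do rewrite big_cons; exact: (integrableD measurableT (fi i) ih1).
rewrite big_cons -ih2 -RintegralD//.
by apply: eq_Rintegral => w _; rewrite big_cons.
Qed.

Lemma Rintegral_itv01 f : measurable_fun [set: T] f ->
  {ae P, forall w, 0 <= f w <= 1} -> 0 <= (\int[P]_w f w)%R <= 1.
Proof.
move=> mf f01; have fi := integrable_ae_itv01 mf f01.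
have ci (c : R) : P.-integrable setT (EFin \o (fun=> c)) by exact: finite_measure_integrable_cst.
apply/andP; split.
  rewrite -(Rintegral_cst_probability 0); apply: ae_le_Rintegral => //.
  by apply: filterS f01 => w /andP[].
rewrite -[leRHS]Rintegral_cst_probability; apply: ae_le_Rintegral => //.
by apply: filterS f01 => w /andP[].
Qed.

(** A variable with values in [0, 1] has a moment generating function no larger
    than that of the Bernoulli variable with the same mean. *)
Lemma mgf_le_chord f t : measurable_fun [set: T] f ->
  {ae P, forall w, 0 <= f w <= 1} ->
  (\int[P]_w (expR (t * f w))%:E <=
   (1 + (\int[P]_w f w)%R * (expR t - 1))%:E)%E.
Proof.
move=> mf f01; have fi := integrable_ae_itv01 mf f01.
have ci (c : R) : P.-integrable setT (EFin \o (fun=> c)) by exact: finite_measure_integrable_cst.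
have mexp : measurable_fun [set: T] (fun w => expR (t * f w)).
  by apply: measurableT_comp => //; apply: measurable_funM.
have chord : {ae P, forall w, expR (t * f w) <= 1 + f w * (expR t - 1)}.
  by apply: filterS f01 => w; exact: expR_le_chord.
have fci : P.-integrable setT (EFin \o (fun w => f w * (expR t - 1))).
  exact: (integrableZr measurableT _ fi).
have gi : P.-integrable setT (EFin \o (fun w => 1 + f w * (expR t - 1))).
  exact: (integrableD measurableT (ci 1) fci).
have ei : P.-integrable setT (EFin \o (fun w => expR (t * f w))).
  apply: (integrable_ae_abs_le mexp gi); apply: filterS chord => w.
  by rewrite ger0_norm ?expR_ge0.
have := ae_le_Rintegral ei gi chord.
rewrite RintegralD//.
rewrite RintegralZr// Rintegral_cst_probability -lee_fin /Rintegral fineK//.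
exact: integrable_fin_num.
Qed.

End Mean.

(** * Lipschitz utilities and their expectations *)

Section AdmissiblePaths.
Context {R : realType} {M : nat} (a b : 'I_M -> R).
Implicit Types (u : 'I_M -> R -> R) (l : 'I_M -> R).

(** What a path of the random utility satisfies almost surely; [u] and [l] range
    over realizations as well as over expectations, for which the same four
    properties hold ([mean_marginal_admissible]). *)
Definition admissible u l : Prop :=
  [/\ forall m, {in `[a m, b m] &, {homo u m : x y / x <= y}},
      forall m, u m (a m) = 0,
      \sum_m u m (b m) = 1 &
      forall m, {in `[a m, b m] &, forall x y, x <= y -> u m y - u m x <= l m * (y - x)}].

Hypothesis ab : forall m, a m < b m.

Let aI m : a m \in `[a m, b m]. Proof. by rewrite in_itv/= lexx ltW. Qed.
Let bI m : b m \in `[a m, b m]. Proof. by rewrite in_itv/= lexx ltW. Qed.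

Lemma admissible_ge0 u l m x : admissible u l -> x \in `[a m, b m] -> 0 <= u m x.
Proof.
move=> [hu u0 _ _] xI; rewrite -(u0 m); apply: hu => //.
by have := xI; rewrite in_itv => /andP[].
Qed.

Lemma admissible_sum_itv01 u l (x : 'I_M -> R) : admissible u l ->
  (forall m, x m \in `[a m, b m]) -> 0 <= \sum_m u m (x m) <= 1.
Proof.
move=> ul xI; rewrite sumr_ge0/=; last by move=> m _; exact: admissible_ge0 ul _.
have [hu _ <- _] := ul; apply: ler_sum => m _; apply: hu => //.
by have := xI m; rewrite in_itv => /andP[].
Qed.

Lemma admissible_itv01 u l m x : admissible u l -> x \in `[a m, b m] ->
  0 <= u m x <= 1.
Proof.
move=> ul xI; rewrite (admissible_ge0 ul)//=; have [hu u0 u1 _] := ul.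
apply: (@le_trans _ _ (u m (b m))).
  by apply: hu => //; have := xI; rewrite in_itv => /andP[].
rewrite -u1 (bigD1 m)//= lerDl sumr_ge0// => m' _; exact: admissible_ge0 ul _.
Qed.

(** The interval is not reduced to a point, and u m is nondecreasing on it. *)
Lemma admissible_modulus_ge0 u l m : admissible u l -> 0 <= l m.
Proof.
move=> [hu _ _ lu]; have := lu m _ _ (aI m) (bI m) (ltW (ab m)).
have : u m (a m) <= u m (b m) by apply: hu => //; exact: ltW.
rewrite -subr_ge0 => h /(le_trans h); by rewrite pmulr_lge0// subr_gt0.
Qed.

End AdmissiblePaths.

Section Interpolation.
Context {R : realType} {M : nat} {a b : 'I_M -> R} (g : breakpoints a b).
Variables (T : Type) (U : 'I_M -> T -> R -> R) (l : 'I_M -> R) (w : T).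
Hypothesis ul : admissible a b (fun m => U m w) l.

Lemma entry_increments_ge0 m (i : 'I_(nbp g m)) : 0 <= entry (increments g U w) i.
Proof.
rewrite entry_increments subr_ge0; have [hu _ _ _] := ul.
by apply: hu; rewrite ?bp_itv// ?ltW ?bp_lt// ltnW.
Qed.

Lemma sum_entry_increments m :
  \sum_(i < nbp g m) entry (increments g U w) i = U m w (b m).
Proof.
have := pl_marginal_increments (g := g) U w (leqnn (nbp g m)).
have [_ u0 _ _] := ul; rewrite u0 subr0 (bp_last g) => <-.
rewrite -(bp_last g) pl_marginal_bp//.
by apply: eq_big => // i; rewrite ltn_ord.
Qed.

Lemma pl_increments_bp m k : (k <= nbp g m)%N ->
  pl_marginal (increments g U w) m (bp g m k) = U m w (bp g m k).
Proof. by move=> kn; rewrite pl_marginal_increments//; have [_ -> _ _] := ul; rewrite subr0. Qed.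

Lemma pl_increments_itv01 m x : x \in `[a m, b m] ->
  0 <= pl_marginal (increments g U w) m x <= 1.
Proof.
move=> xI; have /andP[-> h] := pl_marginal_itv (@entry_increments_ge0 m) xI.
apply: (le_trans h); rewrite sum_entry_increments.
have bI : b m \in `[a m, b m] by rewrite in_itv/= lexx ltW ?(lower_lt_upper g).
by have /andP[] := admissible_itv01 (lower_lt_upper g) ul bI.
Qed.

Lemma increment_le_mesh m k : (k < nbp g m)%N ->
  U m w (bp g m k.+1) - U m w (bp g m k) <= l m * mesh g.
Proof.
move=> kn; have [_ _ _ lu] := ul.
apply: (le_trans (lu m _ _ (bp_itv (ltnW kn)) (bp_itv kn) (ltW (bp_lt kn)))).
apply: ler_wpM2l; first exact: (admissible_modulus_ge0 (lower_lt_upper g) m ul).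
exact: (step_le_mesh (Ordinal kn)).
Qed.

(** Interpolation is exact at the breakpoints and preserves monotonicity. *)
Lemma pl_increments_error m x : x \in `[a m, b m] ->
  `|pl_marginal (increments g U w) m x - U m w x| <= l m * mesh g.
Proof.
move=> xI; rewrite -[leRHS]add0r; have [hu _ _ _] := ul.
apply: (monotone_sandwich (g := g)) => //.
- exact: (pl_marginal_homo (@entry_increments_ge0 m)).
- by rewrite mulr_ge0 ?mesh_ge0//; exact: (admissible_modulus_ge0 (lower_lt_upper g) m ul).
- by move=> i im; rewrite pl_increments_bp// subrr normr0.
- by move=> i im; exact: increment_le_mesh.
Qed.

End Interpolation.

Section ExpectedUtility.
Context {R : realType} {M : nat} (a b : 'I_M -> R).
Context {d : measure_display} {T : measurableType d} (P : probability T R).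
Variables (U : 'I_M -> T -> R -> R) (L : 'I_M -> T -> R).
Hypothesis ab : forall m, a m < b m.
Hypothesis hU : random_utility P a b U.
Hypothesis hLmeas : forall m, measurable_fun [set: T] (L m).
Hypothesis hLip : {ae P, forall w, forall m,
  (L m w).-lipschitz_(`[a m, b m]) (U m w)}.
Hypothesis hL : forall m, ('E_P[L m] < +oo)%E.

Definition mean_marginal m (x : R) : R := (\int[P]_w U m w x)%R.
Definition mean_modulus m : R := (\int[P]_w L m w)%R.

Lemma ae_admissible :
  {ae P, forall w, admissible a b (fun m => U m w) (fun m => L m w)}.
Proof.
have [_ hmono hnorm] := hU.
apply: filterS3 hmono hnorm hLip => w h1 [_ h2] h3; split.
- by move=> m; have [] := h1 m.
- by move=> m; have [] := h1 m.
- by rewrite -h2 /total_utility; apply: eq_bigr => m _; rewrite mxE.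
- move=> m x y xI yI xy.
  have /= := h3 m (y, x) (conj yI xI).
  by rewrite (ger0_norm (_ : 0 <= y - x)) ?subr_ge0//; apply: le_trans; exact: ler_norm.
Qed.

Let mU m x : x \in `[a m, b m] -> measurable_fun [set: T] (fun w => U m w x).
Proof. by have [h _ _] := hU; exact: h. Qed.

Lemma marginal_itv01 m x : x \in `[a m, b m] -> {ae P, forall w, 0 <= U m w x <= 1}.
Proof.
by move=> xI; apply: filterS ae_admissible => w h; exact: (admissible_itv01 ab h xI).
Qed.

Lemma integrable_marginal m x : x \in `[a m, b m] ->
  P.-integrable setT (EFin \o (fun w => U m w x)).
Proof. by move=> xI; apply: integrable_ae_itv01; [exact: mU|exact: marginal_itv01]. Qed.

Lemma integrable_modulus m : P.-integrable setT (EFin \o L m).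
Proof.
apply/integrableP; split; first exact/measurable_EFinP.
rewrite (_ : integral _ _ _ = 'E_P[L m])%E// unlock.
apply: ae_eq_integral => //.
- by apply: measurableT_comp => //; exact/measurable_EFinP.
- exact/measurable_EFinP.
apply: filterS ae_admissible => w h _ /=.
by rewrite ger0_norm//; exact: (admissible_modulus_ge0 ab m h).
Qed.

Lemma mean_modulus_ge0 m : 0 <= mean_modulus m.
Proof.
rewrite -(Rintegral_cst_probability P 0); apply: ae_le_Rintegral.
- exact: finite_measure_integrable_cst.
- exact: integrable_modulus.
- by apply: filterS ae_admissible => w h; exact: (admissible_modulus_ge0 ab m h).
Qed.

Lemma mean_marginal_admissible : admissible a b mean_marginal mean_modulus.
Proof.
have bI m : b m \in `[a m, b m] by rewrite in_itv/= lexx ltW.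
split.
- move=> m x y xI yI xy; apply: ae_le_Rintegral; try exact: integrable_marginal.
  by apply: filterS ae_admissible => w [h _ _ _]; exact: h.
- move=> m; rewrite -(Rintegral_cst_probability P 0).
  have aI : a m \in `[a m, b m] by rewrite in_itv/= lexx ltW.
  have iU := integrable_marginal aI.
  have i0 : P.-integrable setT (EFin \o (fun=> 0 : R)) by exact: finite_measure_integrable_cst.
  apply/eqP; rewrite eq_le; apply/andP; split; apply: ae_le_Rintegral => //;
  by apply: filterS ae_admissible => w [_ -> _ _].
- have [i1 <-] := Rintegral_sum (index_enum 'I_M) (fun m => integrable_marginal (bI m)).
  rewrite -[RHS](Rintegral_cst_probability P 1).
  have i0 : P.-integrable setT (EFin \o (fun=> 1 : R)) by exact: finite_measure_integrable_cst.
  apply/eqP; rewrite eq_le; apply/andP; split; apply: ae_le_Rintegral => //;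
  by apply: filterS ae_admissible => w [_ _ -> _].
- move=> m x y xI yI xy; rewrite /mean_marginal /mean_modulus.
  have [iX iY] := (integrable_marginal xI, integrable_marginal yI).
  rewrite -RintegralB// -RintegralZr//; last exact: integrable_modulus.
  apply: ae_le_Rintegral.
  + exact: (integrableB measurableT iY iX).
  + exact: (integrableZr measurableT _ (integrable_modulus m)).
  + by apply: filterS ae_admissible => w [_ _ _ h]; exact: h.
Qed.

Lemma expected_utilityE (x : 'rV[R]_M) : (forall m, x 0 m \in `[a m, b m]) ->
  expected_utility P U x = \sum_m mean_marginal m (x 0 m).
Proof.
move=> xI; rewrite /expected_utility unlock.
by have [_ <-] := Rintegral_sum (index_enum 'I_M) (fun m => integrable_marginal (xI m)).
Qed.

Lemma mean_total_modulus :
  fine ('E_P[fun w => (\sum_m L m w)%R])%E = \sum_m mean_modulus m.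
Proof.
rewrite unlock.
by have [_ <-] := Rintegral_sum (index_enum 'I_M) integrable_modulus.
Qed.

Section InterpolatedMean.
Variable g : breakpoints a b.

Definition mean_pl m x : R := (\int[P]_w pl_marginal (increments g U w) m x)%R.

Lemma measurable_increments : measurable_fun [set: T] (increments g U).
Proof.
apply/measurable_fun_tnthP => s.
apply: (eq_measurable_fun (fun w => U (tagnat.sig1 s) w (bp g _ (tagnat.sig2 s).+1)
  - U (tagnat.sig1 s) w (bp g _ (tagnat.sig2 s)))).
  by move=> w _; rewrite /= tnth_mktuple.
by apply: measurable_funB; apply: mU; apply: bp_itv => //; apply: ltnW.
Qed.

Lemma measurable_pl_marginal m x : x \in `[a m, b m] ->
  measurable_fun [set: (total_bp g).-tuple R] (fun v => pl_marginal v m x).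
Proof.
move=> xI; under eq_fun do rewrite pl_marginalE//.
apply: measurable_sum => i; apply: measurable_funM => //.
exact: measurable_tnth.
Qed.

Let mpl m x : x \in `[a m, b m] ->
  measurable_fun [set: T] (fun w => pl_marginal (increments g U w) m x).
Proof.
move=> xI; apply: (measurableT_comp (f := fun v => pl_marginal v m x)).
  exact: measurable_pl_marginal.
exact: measurable_increments.
Qed.

Lemma ae_pl_itv01 m x : x \in `[a m, b m] ->
  {ae P, forall w, 0 <= pl_marginal (increments g U w) m x <= 1}.
Proof.
by move=> xI; apply: filterS ae_admissible => w h; exact: (pl_increments_itv01 g h xI).
Qed.

Lemma mean_pl_itv01 m x : x \in `[a m, b m] -> 0 <= mean_pl m x <= 1.
Proof. by move=> xI; apply: Rintegral_itv01; [exact: mpl|exact: ae_pl_itv01]. Qed.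

Lemma mean_pl_mgf m x t : x \in `[a m, b m] ->
  (\int[P]_w (expR (t * pl_marginal (increments g U w) m x))%:E <=
   (1 + mean_pl m x * (expR t - 1))%:E)%E.
Proof. by move=> xI; apply: mgf_le_chord; [exact: mpl|exact: ae_pl_itv01]. Qed.

(** When the comparison grid is the set of breakpoints, the sampling error is thus
    centred at the true expectation. *)
Lemma mean_pl_bp m k : (k <= nbp g m)%N ->
  mean_pl m (bp g m k) = mean_marginal m (bp g m k).
Proof.
move=> kn; have xI := bp_itv kn; rewrite /mean_pl /mean_marginal /Rintegral.
congr fine; apply: ae_eq_integral => //.
- by apply/measurable_EFinP; exact: mpl.
- by apply/measurable_EFinP; exact: mU.
by apply: filterS ae_admissible => w h _ /=; rewrite (pl_increments_bp h).
Qed.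

Lemma mean_pl_error m x : x \in `[a m, b m] ->
  `|mean_pl m x - mean_marginal m x| <= mean_modulus m * mesh g.
Proof.
move=> xI.
have i1 := integrable_ae_itv01 (mpl xI) (ae_pl_itv01 xI).
have i2 := integrable_marginal xI.
have i12 := integrableB measurableT i1 i2.
rewrite /mean_pl /mean_marginal -RintegralB//.
apply: (le_trans (le_normr_Rintegral _ _)) => //.
rewrite -RintegralZr//; last exact: integrable_modulus.
apply: ae_le_Rintegral.
- exact: (integrable_norm i12).
- exact: (integrableZr measurableT _ (integrable_modulus m)).
- by apply: filterS ae_admissible => w h; exact: (pl_increments_error g h xI).
Qed.

End InterpolatedMean.
End ExpectedUtility.

(** * The sample *)

(** Both sides are integrals against the common image measure. *)
Lemma integral_identical_law (R : realType) d d' d''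
    (S : measurableType d) (T : measurableType d') (E : measurableType d'')
    (Q : probability S R) (P : probability T R) (X : S -> E) (V : T -> E)
    (phi : E -> \bar R) :
  measurable_fun [set: S] X -> measurable_fun [set: T] V ->
  (forall A, measurable A -> pushforward Q X A = pushforward P V A) ->
  measurable_fun [set: E] phi -> (forall x, 0 <= phi x)%E ->
  (\int[Q]_s phi (X s) = \int[P]_w phi (V w))%E.
Proof.
move=> mX mV XV mphi phi0.
pose X' : {mfun S >-> E} := HB.pack X (isMeasurableFun.Build _ _ _ _ _ mX).
pose V' : {mfun T >-> E} := HB.pack V (isMeasurableFun.Build _ _ _ _ _ mV).
have hX := @ge0_integral_pushforward _ _ _ _ _ X' mX Q setT phi measurableT mphi
  (fun y _ => phi0 y).
have hV := @ge0_integral_pushforward _ _ _ _ _ V' mV P setT phi measurableT mphi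
  (fun y _ => phi0 y).
rewrite preimage_setT in hX; rewrite preimage_setT in hV.
by rewrite -[LHS]hX -[RHS]hV; apply: eq_measure_integral => A mA _; exact: XV.
Qed.

Lemma ae_measure_le (R : realType) d (S : measurableType d)
    (Q : probability S R) (A C : set S) : measurable A -> measurable C ->
  {ae Q, forall s, A s -> C s} -> (Q A <= Q C)%E.
Proof.
move=> mA mC [N [mN N0 ACN]].
apply: (le_trans (measure_le_setU Q mA mC mN _)); last by rewrite N0 adde0.
move=> s As; have [Cs|Cs] := pselect (C s); [by left|right].
by apply: ACN => h; apply: Cs; exact: h.
Qed.

Section Sample.
Context {R : realType} {M : nat} (a b : 'I_M -> R).
Context {d : measure_display} {T : measurableType d} (P : probability T R).
Variables (U : 'I_M -> T -> R -> R) (L : 'I_M -> T -> R).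
Hypothesis ab : forall m, a m < b m.
Hypothesis hU : random_utility P a b U.
Hypothesis hLmeas : forall m, measurable_fun [set: T] (L m).
Hypothesis hLip : {ae P, forall w, forall m,
  (L m w).-lipschitz_(`[a m, b m]) (U m w)}.
Hypothesis hL : forall m, ('E_P[L m] < +oo)%E.
Context {dS : measure_display} {S : measurableType dS} (Prob : probability S R).
Variables (g : breakpoints a b) (Vs : nat -> S -> (total_bp g).-tuple R).
Hypothesis hV : iid_sample P (increments g U) Prob Vs.

Let mVs n : measurable_fun [set: S] (Vs n). Proof. by have [] := hV. Qed.
Let mV : measurable_fun [set: T] (increments g U).
Proof. exact: (measurable_increments hU). Qed.

Lemma measurable_sample_mean N : measurable_fun [set: S] (sample_mean Vs N).
Proof.
apply/measurable_fun_tnthP => j.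
apply: (eq_measurable_fun (fun s => N%:R^-1 * \sum_(n < N) tnth (Vs n s) j)).
  by move=> s _; rewrite /= tnth_mktuple.
apply: measurable_funM => //; apply: measurable_sum => n.
by apply: (measurableT_comp (f := fun v => tnth v j)) => //; exact: measurable_tnth.
Qed.

Lemma pl_marginal_sample_mean N s m x : x \in `[a m, b m] ->
  pl_marginal (sample_mean Vs N s) m x =
  N%:R^-1 * \sum_(n < N) pl_marginal (Vs n s) m x.
Proof.
move=> xI; rewrite pl_marginalE//.
under [in RHS]eq_bigr do rewrite pl_marginalE//.
rewrite exchange_big mulr_sumr; apply: eq_bigr => i _.
by rewrite /entry tnth_mktuple mulrCA !mulr_sumr.
Qed.

(** For fixed x the marginal is linear in v, so its value at the sample mean is a
    mean of independent copies of u_m(x; V). *)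
Lemma pl_marginal_tail N m x eta : x \in `[a m, b m] -> 0 < eta <= 1 ->
  (Prob [set s | (eta <= `|pl_marginal (sample_mean Vs N s) m x -
                         mean_pl P U g m x|)%R]
   <= (2 * expR (- (N%:R * eta ^+ 2 / 8)))%:E)%E.
Proof.
move=> xI eta01.
pose Z n s := pl_marginal (Vs n s) m x.
have mpl := measurable_pl_marginal (g := g) xI.
have -> : [set s | eta <= `|pl_marginal (sample_mean Vs N s) m x - mean_pl P U g m x|]
  = [set s | eta <= `|N%:R^-1 * \sum_(n < N) Z n s - mean_pl P U g m x|].
  by apply/seteqP; split => s /=; rewrite pl_marginal_sample_mean.
have [_ idV indV] := hV.
apply: tail_two_sided => //.
- by move=> n; apply: (measurableT_comp (f := fun v => pl_marginal v m x)).
- move=> J A uJ mA; apply: (indV J (fun n => (fun v => pl_marginal v m x) @^-1` A n)) => //.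
  by move=> n; rewrite -[_ @^-1` _]setTI; exact: mpl.
- exact: (mean_pl_itv01 hU hLip g xI).
- move=> n t; rewrite /Z.
  rewrite (@integral_identical_law _ _ _ _ _ _ _ Prob P (Vs n) (increments g U)
    (fun v => (expR (t * pl_marginal v m x))%:E))//.
  + exact: (mean_pl_mgf hU hLip g t xI).
  + exact: idV.
  + apply/measurable_EFinP; apply: measurableT_comp => //.
    exact: measurable_funM.
Qed.

(** A condition on v that makes every marginal nondecreasing and the utility
    [0, 1]-valued, that holds almost surely for V, and that sample means inherit. *)
Definition subprobability_tuple (v : (total_bp g).-tuple R) : Prop :=
  (forall j, 0 <= tnth v j) /\ \sum_m \sum_(i < nbp g m) entry v i <= 1.

Lemma measurable_subprobability_tuple :
  measurable [set v | subprobability_tuple v].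
Proof.
have -> : [set v | subprobability_tuple v] =
    (\bigcap_(j in [set: 'I_(total_bp g)]) [set v | 0 <= tnth v j]) `&`
    [set v | \sum_m \sum_(i < nbp g m) entry v i <= 1].
  apply/seteqP; split => v /= [v0 v1]; split => // j; first by move=> _; exact: v0.
  exact: v0.
apply: measurableI.
  apply: fin_bigcap_measurable => // j _.
  by apply: measurable_set_ge => //; exact: measurable_tnth.
apply: measurable_set_ge => //; apply: measurable_sum => m.
by apply: measurable_sum => i; exact: measurable_tnth.
Qed.

Lemma ae_subprobability_increments :
  {ae P, forall w, subprobability_tuple (increments g U w)}.
Proof.
apply: filterS (ae_admissible hU hLip) => w h; split.
  move=> j; rewrite tnth_mktuple subr_ge0; have [hu _ _ _] := h.
  by apply: hu; rewrite ?bp_itv// ?ltW ?bp_lt// ltnW.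
under eq_bigr do rewrite (sum_entry_increments _ h).
by have [_ _ -> _] := h.
Qed.

Lemma ae_subprobability_sample :
  {ae Prob, forall s, forall n, subprobability_tuple (Vs n s)}.
Proof.
apply/ae_foralln => n; have [_ idV _] := hV.
have mB := measurable_subprobability_tuple.
have mC : measurable [set v | ~ subprobability_tuple v] by exact: measurableC.
exists (Vs n @^-1` [set v | ~ subprobability_tuple v]); split => //.
  by rewrite -[_ @^-1` _]setTI; exact: mVs.
transitivity (P (increments g U @^-1` [set v | ~ subprobability_tuple v])).
  exact: idV n _ mC.
apply: measure_negligible; last exact: ae_subprobability_increments.
by rewrite -[_ @^-1` _]setTI; exact: mV.
Qed.

Lemma subprobability_sample_mean N s :
  (forall n, subprobability_tuple (Vs n s)) ->
  subprobability_tuple (sample_mean Vs N s).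
Proof.
move=> VB; split => [j|].
  rewrite tnth_mktuple mulr_ge0 ?invr_ge0// sumr_ge0// => n _.
  by have [] := VB n.
have [->|N0] := posnP N.
  by rewrite big1// => m _; rewrite big1// => i _; rewrite /entry tnth_mktuple big_ord0 mulr0.
have -> : \sum_m \sum_(i < nbp g m) entry (sample_mean Vs N s) i =
    N%:R^-1 * \sum_(n < N) \sum_m \sum_(i < nbp g m) entry (Vs n s) i.
  rewrite exchange_big mulr_sumr; apply: eq_bigr => m _.
  rewrite exchange_big mulr_sumr; apply: eq_bigr => i _.
  by rewrite /entry tnth_mktuple.
rewrite mulrC ler_pdivrMr ?ltr0n// mul1r.
apply: (@le_trans _ _ (\sum_(n < N) 1)).
  by apply: ler_sum => n _; have [] := VB n.
by rewrite sumr_const card_ord.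
Qed.

End Sample.

(** * Stability of the optimization problem *)

(** The hypothesis forces l >= 0; it is stated for ordered pairs because the
    monotone functions it is applied to are compared that way. *)
Lemma lipschitz_real_continuous (R : realType) (f : R -> R) (l : R) :
  (forall x y, x <= y -> `|f y - f x| <= l * (y - x)) -> continuous f.
Proof.
move=> fl x; apply/cvgrPdist_le => e e0.
have l0 : 0 <= l.
  have := fl 0 1 ler01; rewrite subr0 mulr1; exact: le_trans.
have l1 : 0 < l + 1 by rewrite ltr_wpDl.
near=> y.
have xy : `|x - y| <= e / (l + 1).
  by near: y; apply: cvgr_dist_le; [exact: cvg_id|rewrite divr_gt0].
apply: (@le_trans _ _ (l * `|x - y|)).
  have [h|h] := leP x y.
    by rewrite distrC (le_trans (fl _ _ h))// distrC ler_wpM2l// ler_norm.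
  by rewrite (le_trans (fl _ _ (ltW h)))// ler_wpM2l// ler_norm.
apply: (@le_trans _ _ ((l + 1) * (e / (l + 1)))).
  by apply: ler_pM => //; rewrite lerDl.
by rewrite mulrC divfK ?gt_eqF.
Unshelve. all: by end_near. Qed.

Section Clamp.
Context {R : realType}.
Implicit Types a b x y : R.

(** Projecting onto [a, b] extends a function on the box to a continuous function
    on the whole space. *)
Definition clamp a b x : R := Num.max a (Num.min b x).

Lemma clamp_itv a b x : a <= b -> clamp a b x \in `[a, b].
Proof.
by move=> ab; rewrite in_itv/= /clamp le_max lexx/= ge_max ab ge_min lexx.
Qed.

Lemma clamp_id a b x : x \in `[a, b] -> clamp a b x = x.
Proof.
by rewrite in_itv => /andP[ax xb]; rewrite /clamp min_r// max_r.
Qed.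

Lemma clamp_homo a b : {homo clamp a b : x y / x <= y}.
Proof. by move=> x y xy; rewrite /clamp le_max2// le_min2. Qed.

Lemma clamp_nonexpansive a b x y : a <= b -> x <= y ->
  clamp a b y - clamp a b x <= y - x.
Proof.
move=> ab xy; rewrite /clamp.
by case: (leP b x) => h1; case: (leP b y) => h2; rewrite ?(max_r ab);
  case: (leP a x) => h3; case: (leP a y) => h4; lra.
Qed.

End Clamp.

Section Optimization.
Context {R : realType} {M : nat} (a b : 'I_M -> R).
Implicit Types (K X : set 'rV[R]_M) (F G : 'rV[R]_M -> R).

Definition in_box (x : 'rV[R]_M) : Prop := forall m, x 0 m \in `[a m, b m].

Lemma admissible_continuous u l K : (forall m, a m < b m) ->
  admissible a b u l -> K `<=` in_box ->
  {within K, continuous (fun x => \sum_m u m (x 0 m))}.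
Proof.
move=> ab ul Kbox.
apply: (@subspace_eq_continuous _ _ _ (fun x : 'rV[R]_M => \sum_m u m (clamp (a m) (b m) (x 0 m)))).
  by move=> x /set_mem Kx; apply: eq_bigr => m _; rewrite clamp_id//; exact: Kbox.
apply: continuous_subspaceT; apply: continuous_big => [|m _].
  exact: add_continuous.
move=> x; apply: (@continuous_comp _ _ _ (fun x : 'rV[R]_M => x 0 m)
  (fun t => u m (clamp (a m) (b m) t))).
  exact: coord_continuous.
apply: (@lipschitz_real_continuous _ _ (l m)) => y z yz.
have l0 : 0 <= l m := admissible_modulus_ge0 ab m ul.
have [hu _ _ lu] := ul.
have [yI zI] := (clamp_itv y (ltW (ab m)), clamp_itv z (ltW (ab m))).
have yz' := clamp_homo (a m) (b m) yz.
rewrite ger0_norm ?subr_ge0; last exact: hu.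
apply: (le_trans (lu _ _ _ yI zI yz')); rewrite ler_wpM2l//.
exact: (clamp_nonexpansive (ltW (ab m)) yz).
Qed.

Variable g : breakpoints a b.
Implicit Types (v : (total_bp g).-tuple R).

(** Outside the box [pl_utility] drops to zero on the coordinates concerned; this
    is the continuous function that agrees with it on the box. *)
Definition pl_extension v (x : 'rV[R]_M) : R :=
  \sum_m \sum_(i < nbp g m) ramp (bp g m i) (bp g m i.+1) (x 0 m) * entry v i.

Lemma pl_utilityE v x : in_box x -> pl_utility v x = pl_extension v x.
Proof. by move=> xI; apply: eq_bigr => m _; rewrite pl_marginalE. Qed.

Lemma continuous_pl_extension v : continuous (pl_extension v).
Proof.
apply: continuous_big => [|m _]; first exact: add_continuous.
apply: continuous_big => [|i _]; first exact: add_continuous.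
move=> x.
have h : {for x, continuous (ramp (bp g m i) (bp g m i.+1) \o
    (fun x : 'rV[R]_M => x 0 m))}.
  by apply: continuous_comp; [exact: coord_continuous|exact: continuous_ramp].
exact: (cvgMr_tmp h).
Qed.

Lemma pl_utility_continuous v K : K `<=` in_box ->
  {within K, continuous (pl_utility v)}.
Proof.
move=> Kbox; apply: (@subspace_eq_continuous _ _ _ (pl_extension v) (pl_utility v)).
  by move=> x /set_mem Kx; rewrite pl_utilityE//; exact: Kbox.
exact: (continuous_subspaceT (@continuous_pl_extension v)).
Qed.

Lemma pl_utility_itv01 v x : (forall j, 0 <= tnth v j) ->
  \sum_m \sum_(i < nbp g m) entry v i <= 1 -> in_box x ->
  0 <= pl_utility v x <= 1.
Proof.
move=> v0 v1 xI.
have h m := pl_marginal_itv (fun i => v0 _) (xI m) : 0 <= pl_marginal v m (x 0 m) <= _.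
rewrite sumr_ge0/=; last by move=> m _; have /andP[] := h m.
by apply: le_trans v1; apply: ler_sum => m _; have /andP[] := h m.
Qed.

Lemma optimal_value_dist K F G r : compact K -> K !=set0 ->
  {within K, continuous F} -> {within K, continuous G} ->
  (forall x, K x -> `|F x - G x| <= r) ->
  `|optimal_value K F - optimal_value K G| <= r.
Proof.
move=> cK K0 cF cG FG; rewrite /optimal_value.
have [x [Kx xF ->]] := compact_sup_attained cK K0 cF.
have [y [Ky yG ->]] := compact_sup_attained cK K0 cG.
have := FG _ Kx; have := FG _ Ky; have := xF _ Ky; have := yG _ Kx.
by rewrite !ler_norml => ? ? /andP[? ?] /andP[? ?]; apply/andP; split; lra.
Qed.

(** The comparison grid [g'] is unrelated to the breakpoints [g] over which v is
    interpolated: only the monotonicity of the marginals is used. *)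
Lemma pl_utility_dist v u l eta : admissible a b u l ->
  forall (g' : breakpoints a b),
  (forall j, 0 <= tnth v j) ->
  (forall m (i : 'I_(nbp g' m)), `|pl_marginal v m (bp g' m i.+1) - u m (bp g' m i.+1)| <= eta m) ->
  forall x, in_box x ->
  `|pl_utility v x - \sum_m u m (x 0 m)| <= \sum_m (eta m + l m * mesh g').
Proof.
move=> ul g' v0 veta x xI.
have [hu u0 _ lu] := ul.
rewrite /pl_utility -sumrB; apply: (le_trans (ler_norm_sum _ _ _)).
apply: ler_sum => m _.
have eta0 : 0 <= eta m.
  exact: le_trans (veta m (Ordinal (nbp_gt0 g' m))).
apply: (monotone_sandwich (g := g')) => //.
- exact: (pl_marginal_homo (fun i => v0 _)).
- by rewrite mulr_ge0 ?mesh_ge0//; exact: (admissible_modulus_ge0 (lower_lt_upper g) m ul).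
- case=> [_|i im]; last exact: (veta m (Ordinal im)).
  rewrite (bp_first g') u0 -(bp_first g) pl_marginal_bp// big_pred0_eq//.
  by rewrite subr0 normr0.
- move=> i im; apply: (le_trans (lu m _ _ (bp_itv (ltnW im)) (bp_itv im) (ltW (bp_lt im)))).
  apply: ler_wpM2l; first exact: (admissible_modulus_ge0 (lower_lt_upper g) m ul).
  exact: (step_le_mesh (Ordinal im)).
Qed.

End Optimization.

(** * Events of the sampled problem *)

(** Avoids the distance to B: as an intersection over B this set is visibly closed,
    without any triangle inequality. *)
Definition far_from (R : realType) (M : nat) (B : set 'rV[R]_M) (eps : R) :
  set 'rV[R]_M := [set x | forall y, B y -> eps <= euclidean_norm (x - y)].

Lemma closed_far_from (R : realType) (M : nat) (B : set 'rV[R]_M) (eps : R) :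
  closed (far_from B eps).
Proof.
rewrite (_ : far_from B eps = \bigcap_(y in B)
    ((fun x => euclidean_norm (x - y)) @^-1` [set t | eps <= t])); last first.
  by apply/seteqP; split => x /= h y By; exact: h.
apply: closed_bigI => y _; apply: preimage_closed; last exact: closed_ge.
by move=> x _; exact: continuous_euclidean_distance.
Qed.

Section Events.
Context {R : realType} {M : nat} (a b : 'I_M -> R).
Context {d : measure_display} {T : measurableType d} (P : probability T R).
Variables (U : 'I_M -> T -> R -> R) (L : 'I_M -> T -> R).
Hypothesis ab : forall m, a m < b m.
Hypothesis hU : random_utility P a b U.
Hypothesis hLmeas : forall m, measurable_fun [set: T] (L m).
Hypothesis hLip : {ae P, forall w, forall m,
  (L m w).-lipschitz_(`[a m, b m]) (U m w)}.
Hypothesis hL : forall m, ('E_P[L m] < +oo)%E.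
Variable X : set 'rV[R]_M.
Hypothesis Xbox : X `<=` in_box a b.
Hypothesis cX : compact X.
Hypothesis X0 : X !=set0.

Let ul := mean_marginal_admissible ab hU hLmeas hLip hL.

Lemma expected_utility_continuous K : K `<=` in_box a b ->
  {within K, continuous (expected_utility P U)}.
Proof.
move=> Kbox; apply: (@subspace_eq_continuous _ _ _ _ (expected_utility P U) _
  (admissible_continuous ab ul Kbox)).
by move=> x /set_mem Kx; rewrite (expected_utilityE ab hU hLip)//; exact: Kbox.
Qed.

Lemma expected_utility_itv01 x : in_box a b x -> 0 <= expected_utility P U x <= 1.
Proof.
move=> xI; rewrite (expected_utilityE ab hU hLip)//.
exact: (admissible_sum_itv01 ab ul xI).
Qed.

Context {dS : measure_display} {S : measurableType dS} (Prob : probability S R).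

Section FixedBreakpoints.
Variables (g : breakpoints a b) (Vs : nat -> S -> (total_bp g).-tuple R).
Hypothesis hV : iid_sample P (increments g U) Prob Vs.

Lemma measurable_saa_value K N : K `<=` in_box a b -> compact K -> K !=set0 ->
  measurable_fun [set: S] (saa_value K Vs N).
Proof.
move=> Kbox cK K0.
apply: (eq_measurable_fun (fun s => sup (pl_extension (sample_mean Vs N s) @` K))).
  move=> s _; congr sup; apply: eq_imagel => x Kx.
  by rewrite pl_utilityE//; exact: Kbox.
apply: measurable_sup_compact => // [s|x Kx]; first exact: continuous_pl_extension.
apply: (eq_measurable_fun (fun s => pl_utility (sample_mean Vs N s) x)).
  by move=> s _; rewrite pl_utilityE//; exact: Kbox.
apply: measurable_sum => m.
apply: (measurableT_comp (f := fun v => pl_marginal v m (x 0 m))).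
  by apply: measurable_pl_marginal; exact: Kbox.
exact: (measurable_sample_mean hV).
Qed.

Lemma measurable_value_event N theta eps :
  measurable [set s | eps <= `|saa_value X Vs N s - theta|].
Proof.
apply: measurable_set_ge => //; apply: measurableT_comp => //.
by apply: measurable_funB => //; exact: measurable_saa_value.
Qed.

Lemma compact_saa_solutions N s : compact (saa_solutions X Vs N s).
Proof.
pose G := pl_extension (sample_mean Vs N s).
have cG : continuous G by exact: continuous_pl_extension.
have [z [Xz zmax _]] := compact_sup_attained cX X0 (continuous_subspaceT cG).
have -> : saa_solutions X Vs N s = X `&` (G @^-1` [set t | G z <= t]).
  have GE x : X x -> pl_utility (sample_mean Vs N s) x = G x.
    by move=> Xx; rewrite pl_utilityE//; exact: Xbox.
  apply/seteqP; split => x /= [Xx xmax]; split => //.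
    by rewrite -!GE//; exact: xmax.
  by move=> y Xy; rewrite !GE//; apply: le_trans xmax; exact: zmax.
apply: compact_closedI => //; apply: preimage_closed; last exact: closed_ge.
by move=> x _; exact: cG.
Qed.

Lemma excess_saa_solutionsP N s B eps :
  (eps%:E <= excess (saa_solutions X Vs N s) B)%E <->
  exists2 x, saa_solutions X Vs N s x & far_from B eps x.
Proof. exact/excess_geP/compact_saa_solutions. Qed.

(** Some solution of the sampled problem lies in the compact set K of alternatives
    far from B exactly when the optimal value over K reaches that over X. *)
Lemma measurable_excess_event N B eps :
  measurable [set s | (eps%:E <= excess (saa_solutions X Vs N s) B)%E].
Proof.
pose K := X `&` far_from B eps.
have KX : K `<=` X by move=> x [].
have cK : compact K by apply: compact_closedI => //; exact: closed_far_from.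
have Kbox : K `<=` in_box a b by move=> x /KX; exact: Xbox.
have cu s := @pl_utility_continuous _ _ _ _ g (sample_mean Vs N s).
have [K0|K0] := pselect (K !=set0); last first.
  rewrite (_ : [set s | _] = set0)//; apply/seteqP; split => // s /=.
  by move=> /excess_saa_solutionsP[x [Xx _] Bx]; apply: K0; exists x.
rewrite (_ : [set s | _] = [set s | saa_value X Vs N s <= saa_value K Vs N s]).
  by apply: measurable_set_ge; exact: measurable_saa_value.
apply/seteqP; split => s /=; rewrite /saa_value /optimal_value;
  have [z [[Xz Bz] zmax ->]] := compact_sup_attained cK K0 (cu s _ Kbox);
  have [x [Xx xmax ->]] := compact_sup_attained cX X0 (cu s _ Xbox).
- move=> /excess_saa_solutionsP[y [Xy ymax] By].
  by apply: (le_trans (ymax _ Xx)); exact: zmax.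
- move=> xz; apply/excess_saa_solutionsP; exists z => //; split => // y Xy.
  by apply: le_trans xz; exact: xmax.
Qed.

Let deviates N s r : Prop := exists2 x, in_box a b x &
  r < `|pl_utility (sample_mean Vs N s) x - expected_utility P U x|.

(** Optimal values are no further apart than the objectives. *)
Lemma value_error_deviates N s eps r : r < eps ->
  eps <= `|saa_value X Vs N s - optimal_value X (expected_utility P U)| ->
  deviates N s r.
Proof.
move=> re hs; apply: contrapT => hx.
have : `|saa_value X Vs N s - optimal_value X (expected_utility P U)| <= r.
  apply: optimal_value_dist => // [||x Xx].
  - exact: pl_utility_continuous.
  - exact: expected_utility_continuous.
  - by rewrite leNgt; apply/negP => dx; apply: hx; exists x => //; exact: Xbox.
by move=> /(le_trans hs); rewrite leNgt re.
Qed.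

(** Utilities lie in [0, 1]; this disposes of tolerances above 1, for which a bound
    proportional to 1 / eps^2 leaves no room for rounding a sample size up to 1. *)
Lemma ae_value_error_le1 : {ae Prob, forall s, forall N,
  `|saa_value X Vs N s - optimal_value X (expected_utility P U)| <= 1}.
Proof.
apply: filterS (ae_subprobability_sample hU hLip hV) => s sB N.
have [v0 v1] := subprobability_sample_mean N sB.
rewrite /saa_value /optimal_value.
have [x [Xx _ ->]] := compact_sup_attained cX X0
  (pl_utility_continuous (v := sample_mean Vs N s) Xbox).
have [y [Xy _ ->]] := compact_sup_attained cX X0 (expected_utility_continuous Xbox).
have /andP[u0 u1] := pl_utility_itv01 v0 v1 (Xbox Xx).
have /andP[e0 e1] := expected_utility_itv01 (Xbox Xy).
by rewrite ler_norml; apply/andP; split; lra.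
Qed.

(** Union bound over the right end points of the cells of [g'], where the sampled
    marginal is eta-close to its expectation, which has bias at most [delta] times
    the modulus; the left end points are covered because all marginals vanish at
    the lower end of the interval. *)
Lemma deviation_tail (A : set S) (g' : breakpoints a b) N eta delta r :
  measurable A -> 0 < eta <= 1 ->
  (forall m (i : 'I_(nbp g' m)),
     `|mean_pl P U g m (bp g' m i.+1) - mean_marginal P U m (bp g' m i.+1)|
     <= mean_modulus P L m * delta) ->
  M%:R * eta + (\sum_m mean_modulus P L m) * (delta + mesh g') <= r ->
  (forall s, A s -> deviates N s r) ->
  (Prob A <= ((total_bp g')%:R * (2 * expR (- (N%:R * eta ^+ 2 / 8))))%:E)%E.
Proof.
move=> mA eta01 hdelta hr hA.
pose F (j : 'I_(total_bp g')) := let m := tagnat.sig1 j in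
  let x := bp g' m (tagnat.sig2 j).+1 in
  [set s | eta <= `|pl_marginal (sample_mean Vs N s) m x - mean_pl P U g m x|].
have mF j : measurable (F j).
  apply: measurable_set_ge => //; apply: measurableT_comp => //.
  apply: measurable_funB => //.
  apply: (measurableT_comp (f := fun v => pl_marginal v _ _)).
    by apply: measurable_pl_marginal; exact: bp_itv.
  exact: (measurable_sample_mean hV).
have mC : measurable (\big[setU/set0]_j F j) by exact: bigsetU_measurable.
apply: (@le_trans _ _ (Prob (\big[setU/set0]_j F j))).
  apply: ae_measure_le => //.
  apply: filterS (ae_subprobability_sample hU hLip hV) => s sB As.
  apply: contrapT => nF.
  have [v0 v1] := subprobability_sample_mean N sB.
  have [x xI] := hA _ As; apply/negP; rewrite -leNgt.
  apply: le_trans hr; rewrite (expected_utilityE ab hU hLip)//.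
  have close m (i : 'I_(nbp g' m)) :
      `|pl_marginal (sample_mean Vs N s) m (bp g' m i.+1) -
        mean_marginal P U m (bp g' m i.+1)| <= eta + mean_modulus P L m * delta.
    apply: le_trans (ler_distD (mean_pl P U g m (bp g' m i.+1)) _ _) _.
    apply: lerD; last exact: hdelta.
    apply/ltW; rewrite ltNge; apply/negP => h; apply: nF.
    rewrite -bigcup_seq; exists (tagnat.Rank m i); first by rewrite /= mem_index_enum.
    by rewrite /F /= tagnat.Rank2K/= tagnat.Rank1K.
  apply: (le_trans (pl_utility_dist ul v0 close xI)).
  under eq_bigr do rewrite -addrA -mulrDr.
  by rewrite big_split/= sumr_const card_ord -mulr_suml mulr_natl.
apply: (@le_trans _ _ (\sum_(j < total_bp g') Prob (F j))%E).
  exact: measure_le_bigsetU.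
apply: (@le_trans _ _ (\sum_(j < total_bp g') (2 * expR (- (N%:R * eta ^+ 2 / 8)))%:E)%E).
  by apply: lee_sum => j _; apply: (pl_marginal_tail hU hLip hV) => //; exact: bp_itv.
by rewrite sumEFin sumr_const card_ord -[X in (X%:E <= _)%E]mulr_natl.
Qed.

End FixedBreakpoints.

(** Alternatives at distance eps from all solutions form a compact set, on which
    continuity keeps expected utility below the optimum by a positive gap. *)
Lemma excess_deviates eps : 0 < eps -> exists2 r, 0 < r &
  forall (g : breakpoints a b) (Vs : nat -> S -> (total_bp g).-tuple R) N s,
  (eps%:E <= excess (saa_solutions X Vs N s)
                    (optimal_solutions X (expected_utility P U)))%E ->
  exists2 x, in_box a b x &
    r < `|pl_utility (sample_mean Vs N s) x - expected_utility P U x|.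
Proof.
move=> eps0; set EU := expected_utility P U.
have cEU K : K `<=` in_box a b -> {within K, continuous EU}.
  exact: expected_utility_continuous.
have [z [Xz zmax _]] := compact_sup_attained cX X0 (cEU _ Xbox).
pose K := X `&` far_from (optimal_solutions X EU) eps.
have Kbox : K `<=` in_box a b by move=> x [/Xbox].
have cK : compact K by apply: compact_closedI => //; exact: closed_far_from.
have [r r0 hr] : exists2 r, 0 < r & forall x, K x -> EU x + 2 * r < EU z.
  have [K0|K0] := pselect (K !=set0); last first.
    by exists 1 => // x Kx; case: K0; exists x.
  have [y [[Xy yfar] ymax _]] := compact_sup_attained cK K0 (cEU _ Kbox).
  have yz : EU y < EU z.
    rewrite lt_neqAle zmax// andbT; apply/eqP => yz.
    have : optimal_solutions X EU y by split => // x Xx; rewrite yz; exact: zmax.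
    move=> /yfar; rewrite subrr /euclidean_norm big1 ?sqrtr0 ?leNgt ?eps0//.
    by move=> m _; rewrite mxE expr0n.
  exists ((EU z - EU y) / 3); first by lra.
  by move=> x Kx; have := ymax _ Kx; lra.
exists r => // g Vs N s /excess_saa_solutionsP[x [Xx xmax] xfar].
apply: contrapT => hx.
have dev y : X y -> `|pl_utility (sample_mean Vs N s) y - EU y| <= r.
  by move=> Xy; rewrite leNgt; apply/negP => dy; apply: hx; exists y => //; exact: Xbox.
have := dev _ Xx; have := dev _ Xz; have := xmax _ Xz; have := hr _ (conj Xx xfar).
by rewrite !ler_norml => ? ? /andP[? ?] /andP[? ?]; lra.
Qed.
End Events.

(** * Sample size and consistency *)

Section SampleSize.
Context {R : realType}.
Implicit Types c n eps delta : R.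

(** Solves 2 n exp(- N eps^2 / c) <= delta for N.  The value 0 for eps > 1 is needed
    for the growth rate: rounding up costs 1, which exceeds every multiple of
    1 / eps^2 as eps grows. *)
Definition sample_size c n eps delta : nat :=
  if eps <= 1 then (Num.truncn (c * ln (2 * n / delta) / eps ^+ 2)).+1 else 0%N.

(** For delta at most delta0 < 1, both ln (2 n) and, when eps <= 1, the cost 1 of
    rounding up are absorbed in a multiple of - ln delta / eps^2. *)
Lemma sample_size_O c n : 0 <= c -> 1 <= n -> O_ln_over_sq (sample_size c n).
Proof.
move=> c0 n1 delta0 /andP[d00 d01].
have e0 : 0 < - ln delta0 by rewrite oppr_gt0 ln_lt0// d00.
pose l0 := - ln delta0; pose l2 := ln (2 * n).
have l20 : 0 <= l2 by apply: ln_ge0; lra.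
exists (c * (l2 / l0 + 1) + l0^-1) => eps delta eps0 /andP[d0 dd].
have dl : l0 <= - ln delta by rewrite lerN2 ler_ln ?posrE.
have l0_gt0 : 0 < l0 := e0.
set l := - ln delta in dl.
have l_gt0 : 0 < l by exact: lt_le_trans dl.
have -> : `|ln delta / eps ^+ 2| = l / eps ^+ 2.
  by rewrite normrM normfV (gtr0_norm (exprn_gt0 _ eps0)) -normrN gtr0_norm.
have C0 : 0 <= c * (l2 / l0 + 1) + l0^-1.
  by rewrite addr_ge0 ?invr_ge0 ?mulr_ge0 ?addr_ge0 ?divr_ge0// ltW.
rewrite /sample_size; case: ifPn => [eps1|_]; last first.
  by rewrite mulr_ge0// divr_ge0 ?sqr_ge0// ltW.
have -> : ln (2 * n / delta) = l2 + l.
  by rewrite lnM ?posrE ?invr_gt0// ?lnV ?posrE//; lra.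
have s0 : 0 < eps ^+ 2 by rewrite exprn_gt0.
have s1 : eps ^+ 2 <= 1 by rewrite expr_le1// ltW.
have x0 : 0 <= c * (l2 + l) / eps ^+ 2.
  by rewrite divr_ge0 ?mulr_ge0 ?addr_ge0// ltW.
apply: (@le_trans _ _ (c * (l2 + l) / eps ^+ 2 + 1)).
  by rewrite -natr1 lerD2r; have /andP[] := truncn_itv x0.
rewrite mulrA -[X in _ + X](@divff _ (eps ^+ 2)) ?gt_eqF// -mulrDl.
rewrite ler_pM2r ?invr_gt0//.
have q1 : 1 <= l / l0 by rewrite ler_pdivlMr// mul1r.
apply: (@le_trans _ _ (c * (l2 * (l / l0) + l) + l / l0)).
  apply: lerD; last exact: le_trans q1.
  by rewrite ler_wpM2l// lerD2r ler_peMr.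
by rewrite le_eqVlt; apply/orP; left; apply/eqP; ring.
Qed.

Lemma sample_size_tail c n eps delta (N : nat) : 0 < c -> 0 < n ->
  0 < eps <= 1 -> 0 < delta -> (sample_size c n eps delta <= N)%N ->
  n * (2 * expR (- (N%:R * eps ^+ 2 / c))) <= delta.
Proof.
move=> c0 n0 /andP[e0 e1] d0; rewrite /sample_size e1 => hN.
have s0 : 0 < eps ^+ 2 by rewrite exprn_gt0.
have q0 : 0 < 2 * n / delta by rewrite divr_gt0// mulr_gt0.
have : ln (2 * n / delta) <= N%:R * eps ^+ 2 / c.
  rewrite ler_pdivlMr// -ler_pdivrMr// (mulrC (ln _)).
  have [x0|x0] := leP 0 (c * ln (2 * n / delta) / eps ^+ 2).
    by move: hN; rewrite truncn_lt_nat// => /ltW.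
  by rewrite (le_trans (ltW x0)).
move=> hln.
have h : expR (- (N%:R * eps ^+ 2 / c)) <= (2 * n / delta)^-1.
  by rewrite -[X in _ <= X^-1]lnK ?posrE// -expRN ler_expR lerN2.
rewrite mulrA (mulrC n) -ler_pdivlMl ?mulr_gt0//.
by apply: (le_trans h); rewrite invfM invrK.
Qed.

End SampleSize.

Lemma expR_decay_cvg (R : realType) (C c : R) : 0 < c ->
  (C * expR (- (p.1%:R * c)))%:E
    @[p --> filter_prod (\oo : set_system nat) (\oo : set_system nat)]
    --> (0 : R)%:E.
Proof.
move=> c0.
have geo : (fun N => (C * expR (- c) ^+ N)%:E) @ \oo --> (0 : R)%:E.
  apply: cvg_EFin; first exact: nearW.
  apply: cvg_geometric; rewrite ger0_norm ?expR_ge0//.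
  by rewrite expR_lt1 oppr_lt0.
have -> : (fun p : nat * nat => (C * expR (- (p.1%:R * c)))%:E) =
    (fun N => (C * expR (- c) ^+ N)%:E) \o fst.
  by apply/funext => p /=; rewrite -expRM_natl mulrN.
apply: (cvg_comp _ _ _ geo); exact: cvg_fst.
Qed.

Section Consistency.
Context {R : realType} {M : nat} (a b : 'I_M -> R).
Context {d : measure_display} {T : measurableType d} (P : probability T R).
Variables (U : 'I_M -> T -> R -> R) (L : 'I_M -> T -> R).
Hypothesis ab : forall m, a m < b m.
Hypothesis hU : random_utility P a b U.
Hypothesis hLmeas : forall m, measurable_fun [set: T] (L m).
Hypothesis hLip : {ae P, forall w, forall m,
  (L m w).-lipschitz_(`[a m, b m]) (U m w)}.
Hypothesis hL : forall m, ('E_P[L m] < +oo)%E.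
Context {dS : measure_display} {S : measurableType dS} (Prob : probability S R).
Variables (g : nat -> breakpoints a b)
  (Vs : forall k, nat -> S -> (total_bp (g k)).-tuple R).
Hypothesis hV : forall k, iid_sample P (increments (g k) U) Prob (Vs k).
Hypothesis hmesh : mesh (g k) @[k --> \oo] --> (0 : R).

(** The grid is the set of breakpoints number k0, chosen once for all, so the number
    of points in the union bound depends neither on N nor on k. *)
Lemma deviation_probability_cvg (A : nat * nat -> set S) (r : R) : 0 < r ->
  (forall p, measurable (A p)) ->
  (forall p s, A p s -> exists2 x, in_box a b x &
     r < `|pl_utility (sample_mean (Vs p.2) p.1 s) x - expected_utility P U x|) ->
  Prob (A p) @[p --> filter_prod \oo \oo] --> 0%E.
Proof.
move=> r0 mA hA.
pose EL := \sum_m mean_modulus P L m.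
have EL0 : 0 <= EL.
  by apply: sumr_ge0 => m _; exact: (mean_modulus_ge0 ab hU hLmeas hLip hL).
have frac (x y : R) : 0 <= x -> 0 < y -> x * (r / (3 * (x + y))) <= r / 3.
  move=> x0 y0; have xy : 0 < x + y by rewrite ltr_wpDl.
  rewrite mulrA ler_pdivrMr ?mulr_gt0//.
  have -> : r / 3 * (3 * (x + y)) = x * r + r * y by field.
  by rewrite lerDl mulr_ge0// ltW.
(* A third of r for the M sampling errors; the added r in the denominator keeps
   eta below 1. *)
pose eta : R := r / (3 * (M%:R + r)).
have Mr : 0 < M%:R + r by rewrite ltr_wpDl.
have eta0 : 0 < eta by rewrite divr_gt0// mulr_gt0.
have eta1 : eta <= 1.
  by rewrite ler_pdivrMr ?mulr_gt0// mul1r; have : 0 <= (M%:R : R) by []; lra.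
(* A third of r for the bias of the breakpoints g k and another for the mesh of
   the grid g k0; the added 1 covers EL = 0. *)
pose nu : R := r / (3 * (EL + 1)).
have nu0 : 0 < nu by rewrite divr_gt0// mulr_gt0// ltr_wpDl.
have near_nu : \forall k \near \oo, mesh (g k) <= nu by exact: cvgr_le hmesh _ nu0.
have [k0 hk0] : exists k0, mesh (g k0) <= nu by exact: filter_ex near_nu.
pose C : R := (total_bp (g k0))%:R * 2.
pose c : R := eta ^+ 2 / 8.
have c0 : 0 < c by rewrite divr_gt0// exprn_gt0.
apply: (squeeze_cvge _ (cvg_cst 0%E) (expR_decay_cvg C c0)).
have near_p : filter_prod (\oo : set_system nat) (\oo : set_system nat)
    [set p : nat * nat | mesh (g p.2) <= nu].
  exact: (cvg_snd near_nu).
apply: filterS near_p => -[N k] /= hk; rewrite measure_ge0/=.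
apply: (le_trans (deviation_tail ab hU hLmeas hLip hL (hV k) (g' := g k0)
  (delta := nu) (eta := eta) (r := r) (mA (N, k)) _ _ _ (hA (N, k)))).
- by rewrite eta0.
- move=> m i; apply: (le_trans (mean_pl_error ab hU hLmeas hLip hL (g k) (bp_itv (ltn_ord i)))).
  by rewrite ler_wpM2l//; exact: (mean_modulus_ge0 ab hU hLmeas hLip hL).
- have h1 : M%:R * eta <= r / 3 by exact: frac.
  have h2 : EL * nu <= r / 3 by exact: frac.
  have h3 : EL * mesh (g k0) <= EL * nu by rewrite ler_wpM2l.
  by rewrite mulrDr -/EL; lra.
- by rewrite lee_fin /C /c mulrA !mulrA.
Qed.

End Consistency.

Theorem proposition7 (R : realType) (M : nat) (a b : 'I_M -> R)
  (d : measure_display) (T : measurableType d) (P : probability T R)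
  (U : 'I_M -> T -> R -> R) (hU : random_utility P a b U)
  (X : set 'rV[R]_M) (hXbox : forall x m, X x -> x 0 m \in `[a m, b m])
  (hXcompact : compact X) (hX0 : X !=set0)
  (L : 'I_M -> T -> R) (hLmeas : forall m, measurable_fun [set: T] (L m))
  (hLip : {ae P, forall w, forall m,
             (L m w).-lipschitz_(`[a m, b m]) (U m w)})
  (hL : forall m, ('E_P[L m] < +oo)%E)
  (dS : measure_display) (S : measurableType dS) (Prob : probability S R) :
  let theta := optimal_value X (expected_utility P U) in
  let Xstar := optimal_solutions X (expected_utility P U) in
  let EL := fine ('E_P[fun w => (\sum_m L m w)%R])%E in
  (forall (g : breakpoints a b) (Vs : nat -> S -> (total_bp g).-tuple R),
     iid_sample P (increments g U) Prob Vs ->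
     exists2 N0 : R -> R -> nat, O_ln_over_sq N0 &
       forall eps delta : R, 0 < eps -> 0 < delta ->
       forall N : nat, (0 < N)%N -> (N0 eps delta <= N)%N ->
         mesh g <= eps / (2 * EL) ->
         (Prob [set s | (eps <= `|saa_value X Vs N s - theta|)%R]
            <= delta%:E)%E)
  /\
  (forall (g : nat -> breakpoints a b)
     (Vs : forall k, nat -> S -> (total_bp (g k)).-tuple R),
     (forall k, iid_sample P (increments (g k) U) Prob (Vs k)) ->
     total_bp (g k) @[k --> \oo] --> \oo ->
     mesh (g k) @[k --> \oo] --> (0 : R) ->
     forall eps : R, 0 < eps ->
       Prob [set s | eps <= `|saa_value X (Vs p.2) p.1 s - theta|]
         @[p --> filter_prod \oo \oo] --> 0%E
       /\
       Prob [set s | (eps%:E <= excess (saa_solutions X (Vs p.2) p.1 s) Xstar)%E]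
         @[p --> filter_prod \oo \oo] --> 0%E).
Proof.
move=> theta Xstar EL.
have Xbox : X `<=` in_box a b by move=> x Xx m; exact: hXbox.
split.
  move=> g Vs hV.
  have ab := lower_lt_upper g.
  have ELE : EL = \sum_m mean_modulus P L m := mean_total_modulus ab hU hLmeas hLip hL.
  (* With no attribute the total utility would be 0 and not 1. *)
  have M0 : (0 < M)%N.
    have [_ _ sum1 _] := mean_marginal_admissible ab hU hLmeas hLip hL.
    rewrite lt0n; apply/eqP => M0; move: sum1; rewrite big1.
      by move/eqP; rewrite eq_sym oner_eq0.
    by move=> m _; have := ltn_ord m; rewrite [X in (_ < X)%N]M0.
  have n1 : 1 <= (total_bp g)%:R :> R.
    by rewrite ler1n /total_bp (bigD1 (Ordinal M0))//= addn_gt0 nbp_gt0.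
  have M0' : 0 < M%:R :> R by rewrite ltr0n.
  (* With eta = eps / (4 M) the exponent N eta^2 / 8 equals N eps^2 / (128 M^2). *)
  pose c : R := 128 * M%:R ^+ 2.
  have c0 : 0 < c by rewrite mulr_gt0// exprn_gt0.
  exists (sample_size c (total_bp g)%:R); first exact: sample_size_O (ltW c0) n1.
  move=> eps delta eps0 delta0 N _ hN hmesh.
  have mA := measurable_value_event Xbox hXcompact hX0 hV N theta eps.
  have [eps1|eps1] := leP eps 1; last first.
    rewrite (@le_trans _ _ (Prob set0))//; last by rewrite measure0 lee_fin ltW.
    apply: ae_measure_le => //.
    apply: filterS (ae_value_error_le1 ab hU hLmeas hLip hL Xbox hXcompact hX0 hV) => s h /=.
    by move=> /(lt_le_trans eps1); rewrite ltNge h.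
  pose eta := eps / (4 * M%:R).
  have eta01 : 0 < eta <= 1.
    rewrite divr_gt0 ?mulr_gt0//= ler_pdivrMr ?mulr_gt0// mul1r.
    by have : 1 <= M%:R :> R; [rewrite ler1n|lra].
  have budget : M%:R * eta + (\sum_m mean_modulus P L m) * (0 + mesh g) <= 3 / 4 * eps.
    have -> : M%:R * eta = eps / 4 by rewrite /eta; field; rewrite gt_eqF.
    rewrite add0r -ELE.
    have EL0 : 0 <= EL.
      by rewrite ELE; apply: sumr_ge0 => m _; exact: (mean_modulus_ge0 ab hU hLmeas hLip hL).
    have : EL * mesh g <= eps / 2.
      have [->|EL1] := eqVneq EL 0; first by rewrite mul0r divr_ge0// ltW.
      apply: (le_trans (ler_wpM2l EL0 hmesh)).
      by rewrite le_eqVlt; apply/orP; left; apply/eqP; field.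
    lra.
  have unbiased m (i : 'I_(nbp g m)) :
      `|mean_pl P U g m (bp g m i.+1) - mean_marginal P U m (bp g m i.+1)|
      <= mean_modulus P L m * 0.
    by rewrite (mean_pl_bp hU hLip)// subrr normr0 mulr0.
  apply: (le_trans (deviation_tail ab hU hLmeas hLip hL hV mA eta01 unbiased budget _)).
    move=> s; apply: (value_error_deviates ab hU hLmeas hLip hL Xbox hXcompact hX0); lra.
  have -> : N%:R * eta ^+ 2 / 8 = N%:R * eps ^+ 2 / c.
    by rewrite /eta /c; field; rewrite gt_eqF.
  rewrite lee_fin; apply: (sample_size_tail c0 _ _ delta0 hN); first exact: lt_le_trans n1.
  by rewrite eps0.
move=> g Vs hV _ hmesh eps eps0.
have ab := lower_lt_upper (g 0%N).
split.
  apply: (deviation_probability_cvg ab hU hLmeas hLip hL hV hmesh (r := eps / 2)).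
  - by rewrite divr_gt0.
  - by move=> p; exact: (measurable_value_event Xbox hXcompact hX0 (hV p.2)).
  - move=> p s; apply: (value_error_deviates ab hU hLmeas hLip hL Xbox hXcompact hX0); lra.
have [r r0 hr] := excess_deviates ab hU hLmeas hLip hL Xbox hXcompact hX0 (S := S) eps0.
apply: (deviation_probability_cvg ab hU hLmeas hLip hL hV hmesh r0).
  by move=> p; exact: (measurable_excess_event Xbox hXcompact hX0 (hV p.2)).
by move=> p s hs; exact: (hr (g p.2) (Vs p.2) p.1 s hs).
Qed.
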